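(* Let $r\ge2$. The metric completion of $(\mathcal M^1(\mathcal R_r),d_{\mathfrak h,\mathcal R_r})$ is homeomorphic to the complement of the set of $r$ vertices in an $(r-1)$-simplex.
   Context: $\mathcal R_r$ is the rose graph with one vertex and $r$ loop edges, identified with $[r]=\{1,\dots,r\}$; a length function is $\ell=(\ell^1,\dots,\ell^r)\in\mathbb{R}_{>0}^r$. The entropy $\mathfrak h_{\mathcal R_r}(\ell)$ is $\lim_{t\to\infty}\frac1t\log\#\{\gamma:\ell(\gamma)\le t\}$, where $\gamma$ ranges over based circuits, i.e. cyclically reduced cyclic words... more precisely, reduced edge paths $(e_1,\dots,e_n)$ in oriented edges (each edge $i$ with its two orientations) with $e_{k+1}\ne\bar e_k$ and $e_n\neq\bar e_1$, and $\ell(\gamma)$ is the sum of lengths of the traversed edges. $\mathcal M^1(\mathcal R_r)=\{\ell\in\mathbb{R}_{>0}^r:\mathfrak h_{\mathcal R_r}(\ell)=1\}$ is a smooth hypersurface (entropy is real analytic and strictly convex). The entropy metric on it is the Riemannian metric $\|(\ell,v)\|^2_{\mathfrak h,\mathcal R_r}=\langle v,\operatorname{Hess}\mathfrak h_{\mathcal R_r}(\ell)v\rangle$ for $v$ tangent ($\langle v,\nabla\mathfrak h_{\mathcal R_r}(\ell)\rangle=0$), and $d_{\mathfrak h,\mathcal R_r}$ is the induced path distance (infimum of integrals of the norm along piecewise smooth paths in $\mathcal M^1(\mathcal R_r)$). *)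

(* Defs.v *)
From HB Require Import structures.
From mathcomp Require Import all_boot all_order all_algebra.
From mathcomp Require Import all_classical all_reals all_analysis.

Set Implicit Arguments.
Unset Strict Implicit.
Unset Printing Implicit Defensive.

Import Order.TTheory GRing.Theory Num.Theory.
Import numFieldNormedType.Exports.
Local Open Scope classical_set_scope.
Local Open Scope ring_scope.

Section Rose.
Variables (R : realType) (r : nat).

(** Length functions on the rose R_r: row vectors ell : 'rV[R]_r,
    ell 0 i = length of the i-th loop edge. *)

(** Oriented edges: (i, b) is edge i with orientation b; its reverse is
    (i, ~~ b). *)
Definition oedge := ('I_r * bool)%type.
Definition obar (e : oedge) : oedge := (e.1, ~~ e.2).

Definition based_circuit (s : seq oedge) : bool :=
  (s != [::]) && cycle (fun e f => f != obar e) s.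

Definition path_length (ell : 'rV[R]_r) (s : seq oedge) : R :=
  \sum_(e <- s) ell 0 e.1.

(** #{gamma : ell(gamma) <= t}, as a (counting) sum; it is finite for
    positive length functions. *)
Definition circuit_count (ell : 'rV[R]_r) (t : R) : R :=
  fine (\esum_(s in [set s : seq oedge | based_circuit s /\ path_length ell s <= t])
          (1%:E : \bar R)).

Definition entropy (ell : 'rV[R]_r) : R :=
  lim ((fun t : R => ln (circuit_count ell t) / t) @ +oo).

Definition M1 : set 'rV[R]_r :=
  [set ell : 'rV[R]_r | (forall i, 0 < ell 0 i) /\ entropy ell = 1].

Definition ebasis (i : 'I_r) : 'rV[R]_r := delta_mx 0 i.

Definition grad_entropy (ell : 'rV[R]_r) (i : 'I_r) : R :=
  'D_(ebasis i) entropy ell.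

Definition hess_entropy (ell : 'rV[R]_r) (i j : 'I_r) : R :=
  'D_(ebasis i) ('D_(ebasis j) entropy) ell.

Definition tangent (ell v : 'rV[R]_r) : Prop :=
  \sum_(i < r) v 0 i * grad_entropy ell i = 0.

Definition entropy_sqnorm (ell v : 'rV[R]_r) : R :=
  \sum_(i < r) \sum_(j < r) v 0 i * hess_entropy ell i j * v 0 j.

Definition smooth_curve (g : R -> 'rV[R]_r) : Prop :=
  forall (n : nat) (t : R), derivable (derive1n n g) t 1.

Definition ps_path_in_M1 (gamma : R -> 'rV[R]_r) (x y : 'rV[R]_r) : Prop :=
  [/\ gamma 0 = x, gamma 1 = y,
      (forall t, 0 <= t <= 1 -> M1 (gamma t)) &
      exists (k : nat) (a : nat -> R) (g : nat -> R -> 'rV[R]_r),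
        [/\ a 0%N = 0, a k = 1,
            forall i, (i < k)%N -> a i < a i.+1,
            forall i, (i < k)%N -> smooth_curve (g i) &
            forall i, (i < k)%N -> forall t, a i <= t <= a i.+1 -> gamma t = g i t]].

Definition entropy_length (gamma : R -> 'rV[R]_r) : \bar R :=
  (\int[@lebesgue_measure R]_(t in `[0%R, 1%R])
     (Num.sqrt (entropy_sqnorm (gamma t) (derive1 gamma t)))%:E)%E.

Definition entropy_dist (x y : 'rV[R]_r) : \bar R :=
  ereal_inf [set entropy_length gamma | gamma in (fun g => ps_path_in_M1 g x y)].

Definition simplex_minus_vertices : set 'rV[R]_r :=
  [set x : 'rV[R]_r | (forall i, 0 <= x 0 i) /\ \sum_(i < r) x 0 i = 1 /\
           (forall i, x != ebasis i)].

(** [is_metric_completion_model S dS X d f]: (S, dS) is a complete metric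
    space whose metric topology is the subspace topology of S in R^r, and
    f : X -> S is an isometric map (for d) with dense image.  By uniqueness
    of the metric completion, this says exactly that the metric completion
    of (X, d) is homeomorphic to S. *)
Definition completion_homeomorphic_to (X : set 'rV[R]_r)
    (d : 'rV[R]_r -> 'rV[R]_r -> \bar R) (S : set 'rV[R]_r) : Prop :=
  exists (dS : 'rV[R]_r -> 'rV[R]_r -> R) (f : 'rV[R]_r -> 'rV[R]_r),
        (forall x y, S x -> S y -> (dS x y = 0 <-> x = y)) /\
        (forall x y, S x -> S y -> dS x y = dS y x) /\
        (forall x y z, S x -> S y -> S z -> dS x z <= dS x y + dS y z) /\
        (forall x, S x -> forall e : R, 0 < e -> exists2 del : R, 0 < del &
            forall y, S y -> `|y - x| < del -> dS x y < e) /\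
        (forall x, S x -> forall e : R, 0 < e -> exists2 del : R, 0 < del &
            forall y, S y -> dS x y < del -> `|y - x| < e) /\
        (forall u : nat -> 'rV[R]_r, (forall n, S (u n)) ->
            (forall e : R, 0 < e -> exists N : nat, forall m n,
                 (N <= m)%N -> (N <= n)%N -> dS (u m) (u n) < e) ->
            exists2 z, S z & forall e : R, 0 < e -> exists N : nat,
                 forall n, (N <= n)%N -> dS (u n) z < e) /\
        (forall x, X x -> S (f x)) /\
        (forall x y, X x -> X y -> (dS (f x) (f y))%:E = d x y) /\
        (forall z, S z -> forall e : R, 0 < e -> exists2 x, X x & dS (f x) z < e).

End Rose.

(* Main.v *)
Require Import Defs.
From HB Require Import structures.
From mathcomp Require Import all_boot all_order all_algebra.
From mathcomp Require Import all_classical all_reals all_analysis.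
From mathcomp Require Import measurable_realfun.
From mathcomp Require Import ring lra.

(** Write [phi x = 2 / (1 + exp x)]. The nonbacktracking transfer matrix weighted
    by [exp (- h ell)] has the eigenvector [phi (h ell_i)], with eigenvalue [1]
    exactly when [sum_i phi (h ell_i) = 1]; this equation determines the entropy
    [h], and [p_i = phi ell_i] maps [M1] onto the open simplex. There the entropy
    metric is
      [(sum_i 2 (1 - p_i) / (p_i (2 - p_i)) dp_i^2) / D(p)], where
      [D(p) = sum_i p_i (2 - p_i) / 2 * ln ((2 - p_i) / p_i)].
    At a face the numerator has only the integrable singularity [dp^2 / p], so
    points near a common non-vertex are at small distance. The metric dominates a
    multiple of the Euclidean one, and near a vertex, with [e = 1 - p_i], it
    dominates [(de / (e (K - ln e)))^2], so that the vertices are infinitely far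
    away. Hence the completion adds exactly the boundary minus the vertices. *)

Set Implicit Arguments.
Unset Strict Implicit.
Unset Printing Implicit Defensive.

Import Order.TTheory GRing.Theory Num.Theory.
Import numFieldNormedType.Exports.
Local Open Scope classical_set_scope.
Local Open Scope ring_scope.

(** No Perron-Frobenius theory is invoked: the explicit eigenvector bounds the path counts on both
    sides by multiples of [exp (h t)], which also shows that the limit defining the entropy exists.
    Only iterated partial derivatives of the entropy occur, and along each axis the entropy is the
    inverse of an explicit function of one variable; this takes the place of an implicit function
    theorem. Distances are infima of lengths. A function of one coordinate whose derivative is
    dominated by the speed bounds them from below, and a single straight segment of the simplex
    bounds them from above. Near a vertex the lower bound integrates to [ln (K - ln e)], which is
    unbounded; near a face [dp / sqrt p] integrates to [2 sqrt p], which is continuous up to the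
    face. The completion is not built abstractly: the distance extends by limits to the simplex
    without its vertices, Euclidean completeness supplies the limits of Cauchy sequences, and the
    vertex bound keeps these limits away from the vertices. *)

Section PointwiseDerivatives.
Variable R : realType.
Implicit Types (f g : R -> R) (x a b : R).

(** The differentiation rules are restated for explicit abstractions, so that the derivative of a
    concrete formula is assembled by applying them as terms. *)
Lemma der_cst (c : R) x : is_derive x 1 (fun _ : R => c) 0.
Proof. exact: is_derive_cst. Qed.

Lemma der_id x : is_derive x 1 (fun y : R => y) 1.
Proof. exact: is_derive_id. Qed.

Lemma derD f g x a b : is_derive x 1 f a -> is_derive x 1 g b ->
  is_derive x 1 (fun y => f y + g y) (a + b).
Proof. exact: is_deriveD. Qed.

Lemma derN f x a : is_derive x 1 f a -> is_derive x 1 (fun y => - f y) (- a).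
Proof. exact: is_deriveN. Qed.

Lemma derM f g x a b : is_derive x 1 f a -> is_derive x 1 g b ->
  is_derive x 1 (fun y => f y * g y) (a * g x + f x * b).
Proof.
move=> fa gb; apply: (is_derive_eq (is_deriveM fa gb)).
by rewrite /GRing.scale/= addrC [g x * a]mulrC.
Qed.

Lemma derV f x a : is_derive x 1 f a -> f x != 0 ->
  is_derive x 1 (fun y => (f y)^-1) (- (a / f x ^+ 2)).
Proof.
move=> fa fx0; apply: (is_derive_eq (is_deriveV fx0 fa)).
by rewrite /GRing.scale/= mulNr mulrC.
Qed.

Lemma der_comp f g x a b : is_derive x 1 g b -> is_derive (g x) 1 f a ->
  is_derive x 1 (fun y => f (g y)) (a * b).
Proof. by move=> gb fa; exact: is_derive1_comp. Qed.

Lemma der_sum n (F : 'I_n -> R -> R) (D : 'I_n -> R) (P : pred 'I_n) x :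
  (forall k, is_derive x 1 (F k) (D k)) ->
  is_derive x 1 (fun y => \sum_(k | P k) F k y) (\sum_(k | P k) D k).
Proof.
move=> FD; rewrite (_ : (fun y => _) = \sum_(k | P k) F k); last first.
  by apply/funext => y; rewrite fct_sumE.
elim/big_ind2 : _ => //; first exact: is_derive_cst.
by move=> *; exact: is_deriveD.
Qed.

Lemma is_derive_continuous f x a : is_derive x 1 f a -> {for x, continuous f}.
Proof.
by move=> fa; apply/differentiable_continuous/derivable1_diffP/ex_derive.
Qed.

End PointwiseDerivatives.

(** * The coordinate change [phi] and its inverse [psi] *)

Section Phi.
Variable R : realType.
Implicit Types x p : R.

(** Solution [w] of [w = exp (- x) * (2 - w)]: the eigenvector equation at an edge when all oriented
    edges together weigh [2] and the reverse edge is excluded. *)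
Definition phi x : R := 2 / (1 + expR x).
(** [phi] solves a logistic equation, so its derivatives are polynomials in [phi]; this makes the
    numerator of the metric rational in the simplex coordinates. *)
Definition dphi x : R := - (phi x * (2 - phi x) / 2).
Definition ddphi x : R := phi x * (2 - phi x) * (1 - phi x) / 2.
Definition psi p : R := ln ((2 - p) / p).

Lemma expR1_gt0 x : 0 < 1 + expR x.
Proof. by rewrite addr_gt0// expR_gt0. Qed.

Lemma phi_gt0 x : 0 < phi x.
Proof. by rewrite divr_gt0// expR1_gt0. Qed.

Lemma phi_lt2 x : phi x < 2.
Proof.
by rewrite /phi ltr_pdivrMr ?expR1_gt0// ltr_pMr// ltrDl expR_gt0.
Qed.

Lemma expR_phi x : expR x * phi x = 2 - phi x.
Proof. by rewrite /phi; field; rewrite gt_eqF// expR1_gt0. Qed.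

Lemma expRN_phi x : expR (- x) * (2 - phi x) = phi x.
Proof. by rewrite -expR_phi mulrA -expRD addNr expR0 mul1r. Qed.

Lemma phiK x : psi (phi x) = x.
Proof.
rewrite /psi -expR_phi mulfK; first exact: expRK.
by rewrite gt_eqF// phi_gt0.
Qed.

Lemma psiK p : 0 < p < 2 -> phi (psi p) = p.
Proof.
move=> /andP[p0 p2]; rewrite /phi /psi lnK ?posrE; last first.
  by rewrite divr_gt0// subr_gt0.
by field; rewrite gt_eqF//=; apply/eqP; lra.
Qed.

Lemma phi0 : phi 0 = 1.
Proof. by rewrite /phi expR0; field. Qed.

Lemma ltr_phi : {mono phi : x y /~ x < y}.
Proof.
move=> x y; rewrite /phi ltr_pM2l// ltf_pV2 ?posrE ?expR1_gt0//.
by rewrite ltrD2l ltr_expR.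
Qed.

Lemma phi_lt1 x : (phi x < 1) = (0 < x).
Proof. by rewrite -phi0 ltr_phi. Qed.

Lemma psi_gt0 p : 0 < p < 1 -> 0 < psi p.
Proof. by move=> /andP[p0 p1]; rewrite -phi_lt1 psiK// p0/=; lra. Qed.

Lemma is_derive_phi x : is_derive x 1 phi (dphi x).
Proof.
have x0 : 1 + expR x != 0 by rewrite gt_eqF// expR1_gt0.
apply: (is_derive_eq (derM (der_cst _ x) (derV (derD (der_cst 1 x) (is_derive_expR x)) x0))).
by rewrite /dphi /phi; field.
Qed.

Lemma is_derive_dphi x : is_derive x 1 dphi (ddphi x).
Proof.
have h := is_derive_phi x.
apply: (is_derive_eq (derN (derM (derM h (derD (der_cst 2 x) (derN h))) (der_cst 2^-1 x)))).
by rewrite /ddphi /dphi; field.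
Qed.

Lemma is_derive_psi p : 0 < p < 2 -> is_derive p 1 psi (- 2 / (p * (2 - p))).
Proof.
move=> /andP[p0 p2]; have p0' : p != 0 by rewrite gt_eqF.
have h2 : 0 < (2 - p) / p by rewrite divr_gt0// subr_gt0.
apply: (is_derive_eq (der_comp
  (derM (derD (der_cst 2 p) (derN (der_id p))) (derV (der_id p) p0')) (is_derive1_ln h2))).
by field; rewrite p0'/= -opprB oppr_eq0 subr_eq0 lt_eqF.
Qed.

Lemma dphi_lt0 x : dphi x < 0.
Proof.
by rewrite oppr_lt0 divr_gt0// mulr_gt0 ?phi_gt0// subr_gt0 phi_lt2.
Qed.

End Phi.

(** * The entropy of the rose *)

(** The witness is the inverse of [1] plus the sum of all [1 / F i], which makes sense for empty [I]
    too. *)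
Lemma positive_lower_bound (R : realType) (I : finType) (F : I -> R) :
  (forall i, 0 < F i) -> exists2 c : R, 0 < c & forall i, c <= F i.
Proof.
move=> F0; have s0 : 0 <= \sum_i (F i)^-1.
  by apply: sumr_ge0 => i _; rewrite invr_ge0 ltW.
exists (1 + \sum_i (F i)^-1)^-1; first by rewrite invr_gt0; lra.
move=> i; rewrite -[leRHS]invrK lef_pV2 ?posrE ?invr_gt0 ?F0//; last by lra.
rewrite (bigD1 i)//= addrCA lerDl addr_ge0//.
by apply: sumr_ge0 => j _; rewrite invr_ge0 ltW.
Qed.

Section Counting.
Variables (R : realType) (r : nat) (ell : 'rV[R]_r).
Hypothesis r2 : (2 <= r)%N.
Hypothesis ell0 : forall i, 0 < ell 0 i.
Notation oedge := (oedge r).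

Definition nonbacktracking (e f : oedge) := f != obar e.

(** The fuel [n] bounds the number of edges and makes the recursion structural; a positive lower
    bound on the edge lengths tells how much fuel reaches every path of length at most [T]. *)
Fixpoint npaths n (e : oedge) (T : R) : seq (seq oedge) :=
  if n is n'.+1 then
    if ell 0 e.1 <= T then
      [:: e] :: flatten [seq [seq e :: s | s <- npaths n' f (T - ell 0 e.1)]
                        | f <- enum (nonbacktracking e)]
    else [::]
  else [::].

Lemma path_length_cons e s :
  path_length ell (e :: s) = ell 0 e.1 + path_length ell s.
Proof. by rewrite /path_length big_cons. Qed.

Lemma path_length_ge0 s : 0 <= path_length ell s.
Proof. by apply: sumr_ge0 => e _; exact: ltW. Qed.

Lemma mem_npaths n e T e' s : (e' :: s \in npaths n e T) =
  [&& e' == e, path nonbacktracking e s, path_length ell (e :: s) <= T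
    & (size s < n)%N].
Proof.
elim: n e T e' s => [|n IH] e T e' s; first by rewrite /= in_nil !andbF.
rewrite /= path_length_cons; case: ifPn => [lT|]; last first.
  rewrite -ltNge in_nil => Tl; apply/esym/negP => /and4P[_ _ h _].
  by have := path_length_ge0 s; lra.
rewrite in_cons; apply/orP/and4P => [[/eqP[-> ->]|]|[/eqP-> ps ls ss]].
- by split => //; rewrite /path_length big_nil addr0.
- move=> /flattenP[/= l /mapP[f]]; rewrite mem_enum => ef ->.
  move=> /mapP[[|g u] gu [-> ->]].
    by move: gu; case: (n) => //= m; case: ifP => // _; rewrite in_cons/=
      => /flattenP[l' /mapP[f' _ ->] /mapP[]].
  move: gu; rewrite IH => /and4P[/eqP-> pu lu su]; split => //=.
    by rewrite pu andbT.
  by move: lu; lra.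
- case: s ps ls ss => [|f s] /=; first by left.
  move=> /andP[ef ps] ls ss; right; apply/flattenP.
  exists [seq e :: u | u <- npaths n f (T - ell 0 e.1)].
    by apply/mapP; exists f => //; rewrite mem_enum.
  apply/mapP; exists (f :: s) => //; rewrite IH eqxx ps/= -ltnS ss andbT.
  by move: ls; lra.
Qed.

Lemma nil_npaths n e T : ([::] \in npaths n e T) = false.
Proof.
case: n => //= n; case: ifP => // _; rewrite in_cons/=.
by apply/negP => /flattenP[l /mapP[f _ ->] /mapP[]].
Qed.

(** Different second edges [f] give disjoint lists, because [mem_npaths] recovers [f] as the head of
    the remaining path. *)
Lemma uniq_npaths n e T : uniq (npaths n e T).
Proof.
elim: n e T => //= n IH e T; case: ifP => // _ /=; apply/andP; split.
  apply/negP => /flattenP[l /mapP[f _ ->] /mapP[s sn [s0]]].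
  by rewrite -s0 nil_npaths in sn.
have : uniq (enum (nonbacktracking e)) by exact: enum_uniq.
elim: (enum _) => //= f l IHl /andP[fl ul].
rewrite cat_uniq IHl// andbT map_inj_uniq ?IH//=; last by move=> ? ? [].
apply/hasPn => s /flattenP[u /mapP[f' f'l ->] /mapP[s' s'f' ->]].
apply/negP => /mapP[s'' s''f [ss]]; rewrite -ss in s''f.
case: s' s'f' s''f {ss} => [|g s']; first by rewrite nil_npaths.
rewrite !mem_npaths => /and4P[/eqP-> _ _ _] /and4P[/eqP ff _ _ _].
by rewrite -ff f'l in fl.
Qed.

Lemma size_npathsS n e T : (size (npaths n.+1 e T))%:R =
  if ell 0 e.1 <= T
  then 1 + \sum_(f | nonbacktracking e f) (size (npaths n f (T - ell 0 e.1)))%:R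
  else 0 :> R.
Proof.
rewrite /=; case: ifP => // _; rewrite /= -add1n natrD; congr (1 + _).
rewrite size_flatten /shape -map_comp sumnE big_map natr_sum big_enum_cond/=.
by apply: eq_big => [f|f _ /=]; rewrite ?andbT// size_map.
Qed.

Variable h : R.
Hypothesis h0 : 0 < h.
Hypothesis hE : \sum_i phi (h * ell 0 i) = 1.

(* The Perron eigenvector of the nonbacktracking transfer matrix weighted
   by [expR (- h * ell)]; the eigenvalue is [1]. *)
Definition weight (e : oedge) := phi (h * ell 0 e.1).

(** The oriented edges weigh [2] in total, and the only one left out, [obar e], weighs as much as
    [e]; so the sum is [2 - weight e]. *)
Lemma sum_weight e :
  expR (- (h * ell 0 e.1)) * \sum_(f | nonbacktracking e f) weight f = weight e.
Proof.
rewrite -[RHS]expRN_phi; congr (_ * _).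
have -> : 2 = \sum_(f : oedge) weight f.
  rewrite /weight -(pair_bigA _ (fun i (b : bool) => phi (h * ell 0 i)))/=.
  transitivity (\sum_i 2 * phi (h * ell 0 i)).
    by rewrite -mulr_sumr hE mulr1.
  by apply: eq_bigr => i _; rewrite big_bool/= mulrDl mul1r.
by rewrite [in RHS](bigD1 (obar e))//= {2}/weight addrAC subrr add0r.
Qed.

Lemma card_nonbacktracking e : \sum_(f | nonbacktracking e f) 1 = 2 * r%:R - 1 :> R.
Proof.
have : \sum_(f : oedge) 1 = 2 * r%:R :> R.
  by rewrite sumr_const card_prod card_ord card_bool natrM mulrC.
by rewrite (bigD1 (obar e))//= => <-; rewrite addrAC subrr add0r.
Qed.

(** Every edge has [2 r - 1] successors, so the constant solution of the counting recursion
    satisfies [c = 1 + (2 r - 1) c], that is [c = - b]. *)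
Let b : R := (2 * r%:R - 2)^-1.

Let r2R : 2 <= r%:R :> R.
Proof. by rewrite ler_nat. Qed.

Let b0 : 0 < b.
Proof. by rewrite invr_gt0; have := r2R; lra. Qed.

Let bE : 1 - (2 * r%:R - 1) * b = - b.
Proof. by rewrite /b; field; apply/eqP; have := r2R; lra. Qed.

(** Exact solutions of the recursion in [size_npathsS] while [e] still fits: an exponential solution
    of any amplitude [a] plus the constant one. *)
Lemma sum_weight_affine e (a T : R) :
  1 + \sum_(f | nonbacktracking e f)
        (a * weight f * expR (h * (T - ell 0 e.1)) - b) =
  a * weight e * expR (h * T) - b.
Proof.
have -> : \sum_(f | nonbacktracking e f)
    (a * weight f * expR (h * (T - ell 0 e.1)) - b) =
  \sum_(f | nonbacktracking e f) a * weight f * expR (h * (T - ell 0 e.1)) -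
  b * (2 * r%:R - 1).
  rewrite -(card_nonbacktracking e) mulr_sumr -sumrB.
  by apply: eq_bigr => f _; rewrite mulr1.
under eq_bigr do rewrite mulrAC.
rewrite -mulr_sumr mulrBr expRD -(sum_weight e) -bE.
ring.
Qed.

(** Induction on the fuel against the exact solution of amplitude [b / 2]. This amplitude makes the
    solution nonpositive once [e] no longer fits, as [exp (h ell_e) * weight e = 2 - weight e <= 2].
    The bound on [T] ensures that the fuel runs out only when [T < 0]. *)
Lemma size_npaths_ge n e T lmin : (forall i, lmin <= ell 0 i) ->
  T < n%:R * lmin -> b / 2 * weight e * expR (h * T) - b <= (size (npaths n e T))%:R.
Proof.
have base e' T' : T' < ell 0 e'.1 -> b / 2 * weight e' * expR (h * T') - b <= 0.
  move=> Tl; rewrite subr_le0 -mulrA -mulrA ler_piMr ?(ltW b0)//.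
  rewrite mulrC ler_pdivrMr// mul1r mulrC.
  apply: (@le_trans _ _ (expR (h * ell 0 e'.1) * weight e')).
    by rewrite ler_wpM2r ?ler_expR ?ler_pM2l// ltW// phi_gt0.
  by rewrite expR_phi; have := phi_gt0 (h * ell 0 e'.1); lra.
move=> lmin_le; elim: n e T => [|n IH] e T Tn.
  by apply: base; rewrite (lt_trans _ (ell0 _))//; move: Tn; rewrite mul0r.
rewrite size_npathsS; case: ifPn => [lT|]; last by rewrite -ltNge => /base.
rewrite -sum_weight_affine lerD2l; apply: ler_sum => f _; apply: IH.
by have := lmin_le e.1; move: Tn; rewrite -natr1 mulrDl; lra.
Qed.

(** The condition on [A] makes the exact solution of amplitude [A] nonnegative for [T >= 0], which
    settles the cases where the count is [0]. *)
Lemma size_npaths_le n e T A : (forall e, b <= A * weight e) -> 0 <= T ->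
  (size (npaths n e T))%:R <= A * weight e * expR (h * T) - b.
Proof.
move=> bA; have base e' T' : 0 <= T' -> 0 <= A * weight e' * expR (h * T') - b.
  move=> T0; rewrite subr_ge0 (le_trans (bA e'))// ler_peMr//.
    by rewrite (le_trans _ (bA e'))// ltW.
  by rewrite -expR0 ler_expR mulr_ge0// ltW.
elim: n e T => [|n IH] e T T0; first exact: base.
rewrite size_npathsS; case: ifPn => [lT|_]; last exact: base.
rewrite -sum_weight_affine lerD2l; apply: ler_sum => f _; apply: IH; lra.
Qed.

Lemma size_le_path_length lmin s : (forall i, lmin <= ell 0 i) ->
  (size s)%:R * lmin <= path_length ell s.
Proof.
move=> hl; elim: s => [|e s IH]; first by rewrite mul0r /path_length big_nil.
by rewrite path_length_cons -natr1 mulrDl; have := hl e.1; lra.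
Qed.

(** Any finite list covering the circuits shows that the extended sum is a natural number, so [fine]
    loses nothing. *)
Lemma circuit_countE (L : seq (seq oedge)) t :
  (forall s, based_circuit s -> path_length ell s <= t -> s \in L) ->
  circuit_count ell t =
  (size [seq s <- undup L | based_circuit s && (path_length ell s <= t)])%:R.
Proof.
move=> HL; set l := [seq _ <- _ | _].
have ul : uniq l by rewrite filter_uniq// undup_uniq.
rewrite /circuit_count (_ : [set s | _] = [set` l]); last first.
  apply/seteqP; split => s /=; rewrite mem_filter mem_undup.
    by move=> [bs ls]; rewrite bs ls HL.
  by move=> /andP[/andP[]].
rewrite esum_fset; [|exact: finite_seq|by move=> *; rewrite lee_fin].
by rewrite -fsbig_seq// sumEFin/= big_const_seq count_predT iter_addr_0.
Qed.

(** A circuit is in particular a nonbacktracking path from its head, with at most [t / lmin] edges;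
    hence the fuel. *)
Lemma mem_circuit_cover lmin t s : 0 < lmin -> (forall i, lmin <= ell 0 i) ->
  based_circuit s -> path_length ell s <= t ->
  s \in flatten [seq npaths (Num.trunc (t / lmin)).+1 e t | e <- enum {: oedge}].
Proof.
move=> lmin0 lmin_le; case: s => [//|e s] /andP[_ /= es] lt; apply/flattenP.
exists (npaths (Num.trunc (t / lmin)).+1 e t).
  by apply/mapP; exists e => //; rewrite mem_enum.
rewrite mem_npaths eqxx lt/=; move: es; rewrite rcons_path => /andP[-> _]/=.
have h1 := size_le_path_length (e :: s) lmin_le.
have h2 : (size (e :: s))%:R <= t / lmin by rewrite ler_pdivlMr// (le_trans h1).
by rewrite -(ltr_nat R) (le_lt_trans (le_trans _ h2) (truncnS_gt _))// ler_nat.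
Qed.

Lemma circuit_count_le : exists2 c : R, 0 < c &
  forall t, 0 <= t -> circuit_count ell t <= c * expR (h * t).
Proof.
have [lmin lmin0 lmin_le] := positive_lower_bound ell0.
have [x x0 xle] := @positive_lower_bound _ _ weight (fun _ => phi_gt0 _).
have bA e : b <= b / x * weight e.
  by rewrite -mulrA ler_peMr ?(ltW b0)// mulrC ler_pdivlMr// mul1r.
exists (b / x * \sum_e weight e).
  rewrite mulr_gt0 ?divr_gt0//.
  have e0 : oedge by exact: (Ordinal r2, true).
  rewrite (bigD1 e0)//= ltr_pwDl ?phi_gt0//.
  by apply: sumr_ge0 => *; rewrite ltW// phi_gt0.
move=> t t0; rewrite (circuit_countE (fun s => @mem_circuit_cover _ t s lmin0 lmin_le)).
set L := flatten _.
apply: (@le_trans _ _ (size L)%:R).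
  by rewrite ler_nat (leq_trans (size_subseq (filter_subseq _ _)))// size_undup.
rewrite size_flatten /shape -map_comp sumnE big_map natr_sum big_enum.
rewrite mulr_sumr mulr_suml; apply: ler_sum => e _.
by apply: (le_trans (size_npaths_le _ _ bA t0)); rewrite gerBl ltW.
Qed.

(* At most two of the [2r >= 4] edges are forbidden when closing up a path. *)
Lemma exists_closing_edge (e f : oedge) : exists g : oedge,
  (g != obar e) && (g != obar f).
Proof.
have [E|E] := boolP [exists g : oedge, (g != obar e) && (g != obar f)].
  exact/existsP.
have : (#|{: oedge}| <= #|[set obar e; obar f]%SET|)%N.
  apply/subset_leq_card/fintype.subsetP => g _; move/existsPn : E => /(_ g).
  by rewrite !inE negb_and !negbK.
rewrite card_prod card_ord card_bool cards2 => h1.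
have : (2 * 2 <= 2)%N; last by [].
rewrite (leq_trans _ (leq_trans h1 _)) ?leq_mul2r//.
by case: (_ != _).
Qed.

(** A nonbacktracking path from a fixed edge [e0], of length at most [t - lmax], becomes a circuit
    of length at most [t] when one suitable edge is appended. Removing the last edge undoes this, so
    distinct paths give distinct circuits. *)
Lemma circuit_count_ge : exists2 c : R, 0 < c & exists t0, forall t, t0 <= t ->
  c * expR (h * t) <= circuit_count ell t.
Proof.
have [lmin lmin0 lmin_le] := positive_lower_bound ell0.
have [lmax lmax_ge] : exists lmax, forall i, ell 0 i <= lmax.
  exists (\sum_i ell 0 i) => i; rewrite (bigD1 i)//= lerDl.
  by apply: sumr_ge0 => *; exact: ltW.
have e0 : oedge by exact: (Ordinal r2, true).
pose close (s : seq oedge) := rcons s (xchoose (exists_closing_edge (last e0 s) e0)).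
have close_inj : injective close by move=> s1 s2 /eqP; rewrite eqseq_rcons => /andP[/eqP].
have w0 : 0 < b / 2 * weight e0 by rewrite mulr_gt0 ?divr_gt0// phi_gt0.
set a := b / 2 * weight e0 in w0.
exists (a * expR (- (h * lmax)) / 2); first by rewrite divr_gt0// mulr_gt0// expR_gt0.
(* Beyond this point the additive constant is at most half of the main term. *)
exists (lmax + ln (2 * b / a) / h) => t tt0.
have HL s := @mem_circuit_cover _ t s lmin0 lmin_le.
rewrite (circuit_countE HL); pose n := (Num.trunc ((t - lmax) / lmin)).+1.
apply: (@le_trans _ _ (size (map close (npaths n e0 (t - lmax))))%:R).
  rewrite size_map (le_trans _ (size_npaths_ge e0 lmin_le _))//; last first.
    by rewrite -ltr_pdivrMr// truncnS_gt.
  rewrite -/a mulrBr expRD.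
  set u := a * (expR (h * t) * expR (- (h * lmax))).
  suff : 2 * b <= u by rewrite /u; lra.
  have : 2 * b / a <= expR (h * (t - lmax)).
    have <- : expR (ln (2 * b / a)) = 2 * b / a.
      by rewrite lnK// posrE divr_gt0// mulr_gt0.
    rewrite ler_expR.
    by rewrite [leRHS]mulrC -ler_pdivrMr//; lra.
  by rewrite ler_pdivrMr// mulrBr expRD /u; lra.
rewrite ler_nat uniq_leq_size ?(map_inj_uniq close_inj) ?uniq_npaths//.
move=> _ /mapP[s sn ->]; case: s sn => [|e s]; first by rewrite nil_npaths.
rewrite mem_npaths => /and4P[/eqP -> ps ls ss].
rewrite mem_filter mem_undup andbC.
have /andP[g1 g2] := xchooseP (exists_closing_edge (last e0 s) e0).
have closeE : close (e0 :: s) =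
  rcons (e0 :: s) (xchoose (exists_closing_edge (last e0 s) e0)) by [].
rewrite closeE; move: (xchoose _) g1 g2 => {closeE} g g1 g2.
have bc : based_circuit (rcons (e0 :: s) g).
  rewrite /based_circuit /= !rcons_path last_rcons ps/=.
  rewrite /nonbacktracking g1/=; apply: contra g2 => /eqP ->.
  by rewrite /obar /= negbK -surjective_pairing.
have lc : path_length ell (rcons (e0 :: s) g) <= t.
  rewrite /path_length -cats1 big_cat big_seq1/=.
  by have := lmax_ge g.1; rewrite /path_length in ls; lra.
by rewrite HL// bc.
Qed.

(** Both bounds on the count have the form [k * exp (h t)], and
    [ln (k * exp (h t)) / t = h + ln k / t]. *)
Lemma entropy_cvg : (fun t : R => ln (circuit_count ell t) / t) @ +oo --> h.
Proof.
have [c c0 cle] := circuit_count_le.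
have [d d0 [t0 dle]] := circuit_count_ge.
have H k : (fun t : R => h + ln k / t) @ +oo --> h.
  rewrite -[X in _ --> X]addr0; apply: cvgD; first exact: cvg_cst.
  rewrite -[X in _ --> X](mulr0 (ln k)); apply: cvgM; first exact: cvg_cst.
  apply/(@gtr0_cvgV0 _ _ _ _ id); last exact: cvg_id.
  exact: nbhs_pinfty_gt.
apply: (squeeze_cvgr _ (H d) (H c)); near=> t.
have t1 : 0 < t by near: t; exact: nbhs_pinfty_gt.
have t2 : t0 <= t by near: t; by apply: nbhs_pinfty_ge; exact: num_real.
have E k : 0 < k -> h + ln k / t = ln (k * expR (h * t)) / t.
  move=> k0; rewrite lnM ?posrE ?expR_gt0// expRK; field.
  by rewrite gt_eqF.
rewrite !E// !ler_pM2r ?invr_gt0//.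
have p0 : 0 < circuit_count ell t.
  by rewrite (lt_le_trans _ (dle _ t2))// mulr_gt0// expR_gt0.
by rewrite !ler_ln ?posrE ?mulr_gt0 ?expR_gt0// dle// cle// ltW.
Unshelve. all: by end_near. Qed.

Lemma entropyE : entropy ell = h.
Proof. by apply: cvg_lim => //; exact: entropy_cvg. Qed.

End Counting.

Lemma exists_entropy (R : realType) (r : nat) (ell : 'rV[R]_r) :
  (2 <= r)%N -> (forall i, 0 < ell 0 i) ->
  exists2 h, 0 < h & \sum_i phi (h * ell 0 i) = 1.
Proof.
move=> r2 ell0; have [lmin lmin0 lmin_le] := positive_lower_bound ell0.
pose F h := \sum_i phi (h * ell 0 i).
have rR : 2 <= r%:R :> R by rewrite ler_nat.
have F0 : F 0 = r%:R.
  rewrite /F (eq_bigr (fun=> 1)) ?sumr_const ?card_ord// => i _.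
  by rewrite mul0r phi0.
(* At [M] each of the [r] terms is at most [1 / r], since [M * ell_i >= psi (1 / r)]; at [0] each
   term is [1]. The intermediate value theorem applies between the two. *)
pose M := psi (r%:R^-1) / lmin.
have rV : 0 < (r%:R^-1 : R) < 1.
  by rewrite invr_gt0 invf_lt1; [apply/andP; split; lra|lra].
have M0 : 0 < M by rewrite divr_gt0// psi_gt0.
have FM : F M <= 1.
  rewrite (@le_trans _ _ (\sum_(i < r) r%:R^-1))//; last first.
    by rewrite sumr_const card_ord -[_ *+ _]mulr_natr mulVf// gt_eqF//; lra.
  apply: ler_sum => i _; rewrite -[leRHS]psiK; last first.
    by move: rV => /andP[-> h]; rewrite (lt_trans h)// ltr1n.
  rewrite leNgt ltr_phi -leNgt /M -mulrA (ler_peMr (ltW (psi_gt0 rV)))//.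
  by rewrite mulrC ler_pdivlMr// mul1r.
have dF (x : R) : is_derive x 1 F
    (\sum_i dphi (x * ell 0 i) * (1 * ell 0 i + x * 0)).
  apply: (der_sum xpredT) => i.
  exact: (der_comp (derM (der_id x) (der_cst (ell 0 i) x)) (is_derive_phi _)).
have [||h /[!in_itv]/= /andP[h0 hM] Fh] := @IVT R F 0 M 1 (ltW M0).
  - by apply: continuous_subspaceT => x; exact: is_derive_continuous (dF x).
  - by rewrite F0 ge_min le_max FM orbT/=; apply/orP; left; lra.
exists h => //; rewrite lt_neqAle eq_sym h0 andbT; apply/eqP => hE.
by rewrite hE F0 in Fh; lra.
Qed.

Section EntropySpec.
Variables (R : realType) (r : nat).
Hypothesis r2 : (2 <= r)%N.
Implicit Type ell : 'rV[R]_r.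

Lemma entropy_gt0 ell : (forall i, 0 < ell 0 i) -> 0 < entropy ell.
Proof.
by move=> l0; have [h h0 hE] := exists_entropy r2 l0; rewrite (entropyE r2 l0 h0).
Qed.

Lemma sum_phi_entropy ell : (forall i, 0 < ell 0 i) ->
  \sum_i phi (entropy ell * ell 0 i) = 1.
Proof.
by move=> l0; have [h h0 hE] := exists_entropy r2 l0; rewrite (entropyE r2 l0 h0).
Qed.

(** Replaces the limit in the definition of [M1] by the equation of the simplex in the coordinates
    [phi (ell_i)]. *)
Lemma M1P ell : M1 ell <-> (forall i, 0 < ell 0 i) /\ \sum_i phi (ell 0 i) = 1.
Proof.
split=> -[l0 hl]; split => //.
  by rewrite -[RHS](sum_phi_entropy l0) hl; apply: eq_bigr => i _; rewrite mul1r.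
by apply: entropyE => //; rewrite -[RHS]hl; apply: eq_bigr => i _; rewrite mul1r.
Qed.

End EntropySpec.

(** * Gradient and Hessian of the entropy *)

(** Reduces directional derivatives to one real variable, so that no differentiability in several
    variables has to be established. *)
Lemma is_derive_line (R : realType) (V : normedModType R) (f : V -> R) (x v : V) a :
  is_derive (0 : R) 1 (fun s : R => f (s *: v + x)) a -> is_derive x v f a.
Proof.
move=> [df Df]; split; first exact/derivable1P.
rewrite -Df /derive; set g1 := fun h => _; set g2 := fun h => _.
suff -> : g1 = g2 by [].
by apply/funext => h; rewrite /g1 /g2/= addr0 scale0r add0r [_%:A]mulr1.
Qed.

Section Derivatives.
Variables (R : realType) (r : nat).
Hypothesis r2 : (2 <= r)%N.
Implicit Types ell v : 'rV[R]_r.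

(** Derivative of [sum_k phi (h ell_k)] with respect to [h], taken at the entropy. *)
Definition entropy_den ell : R :=
  \sum_k dphi (entropy ell * ell 0 k) * ell 0 k.

Lemma entropy_den_lt0 ell : (forall i, 0 < ell 0 i) -> entropy_den ell < 0.
Proof.
move=> l0; rewrite /entropy_den (bigD1 (Ordinal r2))//=.
rewrite -[ltRHS]addr0 ltr_leD//; first by rewrite pmulr_llt0// dphi_lt0.
by apply: sumr_le0 => k _; rewrite pmulr_lle0// ltW// dphi_lt0.
Qed.

Lemma ebasisE (i k : 'I_r) s ell :
  (s *: ebasis R i + ell) 0 k = s * (k == i)%:R + ell 0 k.
Proof. by rewrite !mxE eqxx. Qed.

Section InverseFunction.
Variables (ell : 'rV[R]_r) (i : 'I_r).
Hypothesis l0 : forall k, 0 < ell 0 k.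
Let h := entropy ell.
Let h0 : 0 < h. Proof. exact: entropy_gt0. Qed.

(** [q t] is the value left for the [i]-th term if the entropy is to be [t], and [m t] is the [i]-th
    length producing this value. *)
Let q (t : R) := 1 - \sum_(k | k != i) phi (t * ell 0 k).
Let m (t : R) := psi (q t) * t^-1.

Let qh : q h = phi (h * ell 0 i).
Proof.
by rewrite /q -(sum_phi_entropy r2 l0) (bigD1 i)//= addrK.
Qed.

Let dq (t : R) : is_derive t 1 q
  (- \sum_(k | k != i) dphi (t * ell 0 k) * ell 0 k).
Proof.
have H : is_derive t 1 (fun s => \sum_(k | k != i) phi (s * ell 0 k))
    (\sum_(k | k != i) dphi (t * ell 0 k) * ell 0 k).
  apply: (der_sum (fun k => k != i)) => k.
  apply: (is_derive_eq
    (der_comp (derM (der_id t) (der_cst (ell 0 k) t)) (is_derive_phi _))).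
  by rewrite mulr0 addr0 mul1r.
exact: (is_derive_eq (derD (der_cst 1 t) (derN H)) (add0r _)).
Qed.

Let dm (t : R) : 0 < t -> 0 < q t < 1 -> is_derive t 1 m
  ((- 2 / (q t * (2 - q t)) * (- \sum_(k | k != i) dphi (t * ell 0 k) * ell 0 k))
   * t^-1 + psi (q t) * - (1 / t ^+ 2)).
Proof.
move=> t0 /andP[q0 q1]; apply: derM; last by apply: (derV (der_id t)); rewrite gt_eqF.
apply: (der_comp (dq t)); apply: is_derive_psi.
by rewrite q0/=; lra.
Qed.

Let near_q : \forall t \near h, 0 < t /\ 0 < q t < 1.
Proof.
have qc := is_derive_continuous (dq h).
have ph : 0 < q h < 1 by rewrite qh phi_gt0 phi_lt1 mulr_gt0.
near=> t; split; first by near: t; exact: lt_nbhsr.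
apply/andP; split; near: t.
  by apply: (cvgr_gt _ qc); case/andP: ph.
by apply: (cvgr_lt _ qc); case/andP: ph.
Unshelve. all: by end_near. Qed.

(* Solving [sum phi (t ell_k) = 1] for the [i]-th length is explicit; the
   entropy along the [i]-th axis is the inverse of this function. *)
Lemma is_derive_entropy_line : is_derive (0 : R) 1
  (fun s => entropy (s *: ebasis R i + ell))
  (- (h * dphi (h * ell 0 i)) / entropy_den ell).
Proof.
(* [H c] is the entropy after the [i]-th length is replaced by [c]. It inverts [m] only where
   [0 < q t < 1], so the cancellation is local around [h]. *)
pose H (c : R) := entropy ((c - ell 0 i) *: ebasis R i + ell).
have mh : m h = ell 0 i by rewrite /m qh phiK mulrC mulKf// gt_eqF.
have Hm : {near h, cancel m H}.
  near=> t; rewrite /H.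
  have [t0 /andP[q0 q1]] : 0 < t /\ 0 < q t < 1 by near: t; exact: near_q.
  have E k : ((m t - ell 0 i) *: ebasis R i + ell) 0 k =
      if k == i then m t else ell 0 k.
    rewrite ebasisE; case: eqP => [->|_]; rewrite ?mulr1 ?mulr0 ?add0r//.
    by rewrite subrK.
  apply: entropyE => //.
    move=> k; rewrite E; case: ifP => // _.
    by rewrite /m mulr_gt0 ?invr_gt0// psi_gt0// q0.
  rewrite (bigD1 i)//= E eqxx /m mulrCA mulfV ?gt_eqF// mulr1 psiK; last first.
    by rewrite q0/=; lra.
  rewrite /q; set u := \sum_(_ | _) _; set w := \sum_(_ | _) _.
  suff -> : w = u by rewrite subrK.
  by apply: eq_bigr => k ki; rewrite E (negPf ki).
have mC : {near h, continuous m}.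
  near=> t; have [t0 qt] : 0 < t /\ 0 < q t < 1 by near: t; exact: near_q.
  exact: is_derive_continuous (dm t0 qt).
have dmh : is_derive h 1 m (- entropy_den ell / (h * dphi (h * ell 0 i))).
  have [t0 qt] : 0 < h /\ 0 < q h < 1 by exact: nbhs_singleton near_q.
  apply: (is_derive_eq (dm t0 qt)).
  rewrite qh phiK /entropy_den [in RHS](bigD1 i)//= -/h.
  set S := \sum_(_ | _) _; rewrite /dphi.
  move: (phi_gt0 (h * ell 0 i)) (phi_lt2 (h * ell 0 i)).
  set p := phi _ => p0 p2; field.
  by rewrite !gt_eqF// subr_gt0.
have D0 := entropy_den_lt0 l0; have dp0 := dphi_lt0 (h * ell 0 i).
have neq0 : - entropy_den ell / (h * dphi (h * ell 0 i)) != 0.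
  by rewrite mulf_eq0 oppr_eq0 (lt_eqF D0) invr_eq0 mulf_eq0 (lt_eqF dp0) (gt_eqF h0).
have := is_derive_inverse Hm mC dmh neq0; rewrite mh => dH.
have -> : (fun s => entropy (s *: ebasis R i + ell)) = fun s => H (s + ell 0 i).
  by apply/funext => s; rewrite /H addrK.
have d1 := derD (der_id (0 : R)) (der_cst (ell 0 i) 0).
have dH' : is_derive (0 + ell 0 i) 1 H
   (- entropy_den ell / (h * dphi (h * ell 0 i)))^-1 by rewrite add0r.
apply: (is_derive_eq (der_comp d1 dH')); field.
by rewrite (lt_eqF D0) (lt_eqF dp0) (gt_eqF h0).
Unshelve. all: by end_near. Qed.

End InverseFunction.

Lemma derive_entropy ell i : (forall k, 0 < ell 0 k) ->
  'D_(ebasis R i) (@entropy R r) ell =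
  - (entropy ell * dphi (entropy ell * ell 0 i)) / entropy_den ell.
Proof.
by move=> l0; have [] := is_derive_line (is_derive_entropy_line i l0).
Qed.

(** The gradient formula holds for positive lengths; differentiating it once more requires it on a
    neighbourhood. *)
Lemma near_line_gt0 ell i : (forall k, 0 < ell 0 k) ->
  \forall s \near (0 : R), forall k, 0 < (s *: ebasis R i + ell) 0 k.
Proof.
move=> l0.
apply: (@filter_forall R 'I_r (fun k s => 0 < (s *: ebasis R i + ell) 0 k)
  (nbhs (0 : R)) (nbhs_filter (0 : R))) => k.
suff : {for (0:R), continuous (fun s : R => (s *: ebasis R i + ell) 0 k)}.
  by move=> /cvgr_gt; apply; rewrite scale0r add0r.
rewrite (_ : (fun s : R => _) = fun s => s * (k == i)%:R + ell 0 k); last first.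
  by apply/funext => s; rewrite ebasisE.
exact: is_derive_continuous
  (derD (derM (der_id (0:R)) (der_cst _ (0:R))) (der_cst _ (0:R))).
Qed.

(** Differentiating the denominator contributes [dphi (h * ell 0 j)] times a factor depending on [i]
    alone. Such a term vanishes on tangent vectors, so the factor [K] is left unspecified. *)
Lemma hess_entropyE ell : (forall k, 0 < ell 0 k) ->
  exists K : 'I_r -> R, forall i j,
  let h := entropy ell in
  let hi := - (h * dphi (h * ell 0 i)) / entropy_den ell in
  hess_entropy ell i j =
  - (hi * dphi (h * ell 0 j) +
     h * (ddphi (h * ell 0 j) * (hi * ell 0 j + h * (j == i)%:R))) / entropy_den ell +
  h * dphi (h * ell 0 j) * K i.
Proof.
move=> l0; set h := entropy ell.
pose hi i := - (h * dphi (h * ell 0 i)) / entropy_den ell.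
pose U i k := hi i * ell 0 k + h * (k == i)%:R.
pose G i := \sum_k (ddphi (h * ell 0 k) * U i k * ell 0 k
                    + dphi (h * ell 0 k) * (k == i)%:R).
exists (fun i => G i / entropy_den ell ^+ 2) => i j /=; rewrite -/(hi i).
rewrite /hess_entropy.
pose lin s := s *: ebasis R i + ell.
pose F s := - (entropy (lin s) * dphi (entropy (lin s) * lin s 0 j))
   * (\sum_k dphi (entropy (lin s) * lin s 0 k) * lin s 0 k)^-1.
have lin0 : lin 0 = ell by rewrite /lin scale0r add0r.
have dlin k : is_derive (0:R) 1 (fun s => lin s 0 k) (k == i)%:R.
  rewrite (_ : (fun s => _) = fun s => s * (k == i)%:R + ell 0 k); last first.
    by apply/funext => s; rewrite /lin ebasisE.
  apply: (is_derive_eq (derD (derM (der_id (0:R)) (der_cst _ (0:R))) (der_cst _ _))).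
  by rewrite mulr0 !addr0 mul1r.
have dh : is_derive (0:R) 1 (fun s => entropy (lin s)) (hi i).
  exact: is_derive_entropy_line.
have du k : is_derive (0:R) 1 (fun s => entropy (lin s) * lin s 0 k) (U i k).
  by apply: (is_derive_eq (derM dh (dlin k))); rewrite lin0.
have dF : is_derive (0:R) 1 F
   (- (hi i * dphi (h * ell 0 j) + h * (ddphi (h * ell 0 j) * U i j))
     / entropy_den ell + h * dphi (h * ell 0 j) * (G i / entropy_den ell ^+ 2)).
  have dG : is_derive (0:R) 1
     (fun s => \sum_k dphi (entropy (lin s) * lin s 0 k) * lin s 0 k) (G i).
    apply: (der_sum xpredT) => k.
    apply: (is_derive_eq (derM (der_comp (du k) (is_derive_dphi _)) (dlin k))).
    by rewrite lin0.
  have G0 : \sum_k dphi (entropy (lin 0) * lin 0 0 k) * lin 0 0 k != 0.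
    by rewrite lin0 lt_eqF// entropy_den_lt0.
  apply: (is_derive_eq (derM (derN (derM dh (der_comp (du j) (is_derive_dphi _))))
     (derV dG G0))).
  by rewrite lin0 -/(entropy_den ell) -/h; ring.
suff [] : is_derive ell (ebasis R i) ('D_(ebasis R j) (@entropy R r)) 
   (- (hi i * dphi (h * ell 0 j) + h * (ddphi (h * ell 0 j) * U i j))
     / entropy_den ell + h * dphi (h * ell 0 j) * (G i / entropy_den ell ^+ 2)).
  by [].
apply: is_derive_line; apply: near_eq_is_derive dF.
near=> s; rewrite derive_entropy//.
by near: s; exact: near_line_gt0.
Unshelve. all: by end_near. Qed.

Definition metric_den ell : R := - \sum_k dphi (ell 0 k) * ell 0 k.

Definition sqnorm_on_M1 ell v : R :=
  (\sum_k ddphi (ell 0 k) * v 0 k ^+ 2) / metric_den ell.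

(* On tangent vectors every term of the Hessian but the diagonal one drops out. *)
Lemma entropy_sqnormE ell v : M1 ell -> \sum_k dphi (ell 0 k) * v 0 k = 0 ->
  entropy_sqnorm ell v = sqnorm_on_M1 ell v.
Proof.
move=> [l0 h1] tv; have [K HK] := hess_entropyE l0.
have D0 : entropy_den ell != 0 by rewrite lt_eqF// entropy_den_lt0.
rewrite /entropy_sqnorm /sqnorm_on_M1.
have DE : metric_den ell = - entropy_den ell.
  rewrite /metric_den /entropy_den h1; congr (- _).
  by apply: eq_bigr => k _; rewrite mul1r.
rewrite DE; set D := entropy_den ell in D0 HK *.
pose a k := dphi (ell 0 k) * v 0 k.
pose b k := ddphi (ell 0 k) * ell 0 k * v 0 k.
transitivity (\sum_i \sum_j
  (a i * (a j / D ^+ 2) + a i * (b j / D ^+ 2)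
   + (- (ddphi (ell 0 j) * v 0 i * v 0 j * (j == i)%:R / D) + v 0 i * K i * a j))).
  apply: eq_bigr => i _; apply: eq_bigr => j _.
  by rewrite HK h1 !mul1r /a /b; field.
have a0 : \sum_k a k = 0 by exact: tv.
under eq_bigr do rewrite !big_split/= -!mulr_sumr -!mulr_suml a0 !mul0r !mulr0 add0r addr0.
rewrite !big_split/= -mulr_suml a0 mul0r add0r invrN mulrN -mulNr -sumrN mulr_suml.
apply: eq_bigr => i _; rewrite (bigD1 i)//= big1 ?addr0; last first.
  by move=> j ji; rewrite (negPf ji) mulr0 mul0r oppr0.
by rewrite eqxx mulr1; field.
Qed.

End Derivatives.

(** * Integrals of piecewise continuous functions *)

Section Integrals.
Variable R : realType.
Notation mu := (@lebesgue_measure R).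
Implicit Types (f F H G : R -> R) (a b t : R).

(** Two-sided continuity also at the endpoints: the integrands come from curves that are smooth on
    the whole line. *)
Definition continuous_seg f a b := forall t, a <= t <= b -> {for t, continuous f}.

Lemma continuous_seg_within f a b : continuous_seg f a b ->
  {within `[a, b], continuous f}.
Proof.
move=> fC; apply: continuous_in_subspaceT => t.
by rewrite inE/= in_itv/= => tab; exact: fC.
Qed.

Lemma continuous_seg_integrable f a b : continuous_seg f a b ->
  mu.-integrable `[a, b] (EFin \o f).
Proof.
move=> fC; apply: continuous_compact_integrable; first exact: segment_compact.
exact: continuous_seg_within.
Qed.

Lemma continuous_seg_primitive f a b : a < b -> continuous_seg f a b ->
  exists G : R -> R, [/\ {within `[a, b], continuous G},
    (forall t, a < t < b -> is_derive t 1 G (f t)) &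
    (\int[mu]_(t in `[a, b]) (f t)%:E = (G b - G a)%:E)%E].
Proof.
move=> ab fC; have fI := continuous_seg_integrable fC.
exists (fun x => \int[mu]_(t in `[a, x]) f t); split.
- by apply: parameterized_integral_continuous; rewrite ?ltW.
- move=> t /andP[at_ tb].
  have [] := continuous_FTC1_closed tb fI at_ (fC _ _); first by rewrite !ltW.
  by move=> dG <-; rewrite derive1E; exact: derivableP.
- rewrite set_itv1 Rintegral_set1 subr0 /Rintegral fineK//.
  exact: integrable_fin_num fI.
Qed.

(** For a primitive [G] of [f], the difference [H - G] is nondecreasing. Comparing primitives avoids
    integrating [dH]. *)
Lemma integral_le_increment f H dH a b : a < b -> continuous_seg f a b ->
  (forall t, a <= t <= b -> is_derive t 1 H (dH t)) ->
  (forall t, a < t < b -> f t <= dH t) ->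
  (\int[mu]_(t in `[a, b]) (f t)%:E <= (H b - H a)%:E)%E.
Proof.
move=> ab fC HdH fH; have [G [Gc dG ->]] := continuous_seg_primitive ab fC.
rewrite lee_fin.
have D t : a < t < b -> is_derive t 1 (fun x => H x - G x) (dH t - f t).
  move=> tab; apply: (derD _ (derN (dG _ tab))); apply: HdH.
  by case/andP: tab => *; rewrite !ltW.
suff : H a - G a <= H b - G b by lra.
apply: (@ger0_derive1_le_cc _ (fun x => H x - G x) a b).
- by move=> t; rewrite in_itv/= => /D[].
- move=> t; rewrite in_itv/= => tab; rewrite derive1E (@derive_val _ _ _ _ _ _ _ (D _ tab)).
  by rewrite subr_ge0 fH.
- have Hc : {within `[a, b], continuous H}.
    by apply: continuous_seg_within => t tab; exact: is_derive_continuous (HdH _ tab).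
  by move=> x; apply: continuousB; [exact: Hc|exact: Gc].
- by rewrite in_itv/= lexx ltW.
- by rewrite in_itv/= lexx ltW.
- exact: ltW.
Qed.

Lemma increment_le_integral f H dH a b : a < b -> continuous_seg f a b ->
  (forall t, a <= t <= b -> is_derive t 1 H (dH t)) ->
  (forall t, a < t < b -> dH t <= f t) ->
  ((H b - H a)%:E <= \int[mu]_(t in `[a, b]) (f t)%:E)%E.
Proof.
move=> ab fC HdH fH; have [G [Gc dG ->]] := continuous_seg_primitive ab fC.
rewrite lee_fin.
have D t : a < t < b -> is_derive t 1 (fun x => G x - H x) (f t - dH t).
  move=> tab; apply: (derD (dG _ tab) (derN _)); apply: HdH.
  by case/andP: tab => *; rewrite !ltW.
suff : G a - H a <= G b - H b by lra.
apply: (@ger0_derive1_le_cc _ (fun x => G x - H x) a b).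
- by move=> t; rewrite in_itv/= => /D[].
- move=> t; rewrite in_itv/= => tab; rewrite derive1E (@derive_val _ _ _ _ _ _ _ (D _ tab)).
  by rewrite subr_ge0 fH.
- have Hc : {within `[a, b], continuous H}.
    by apply: continuous_seg_within => t tab; exact: is_derive_continuous (HdH _ tab).
  by move=> x; apply: continuousB; [exact: Gc|exact: Hc].
- by rewrite in_itv/= lexx ltW.
- by rewrite in_itv/= lexx ltW.
- exact: ltW.
Qed.

Lemma integral_affine f a (c : R) : 0 < c -> continuous_seg f a (a + c) ->
  (\int[mu]_(t in `[a, (a + c)%R]) (f t)%:E =
   \int[mu]_(s in `[0%R, 1%R]) (c * f (a + c * s))%:E)%E.
Proof.
move=> c0 fC; pose F (s : R) := a + c * s.
have dF (s : R) : is_derive s 1 F c.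
  apply: (is_derive_eq (derD (der_cst a s) (derM (der_cst c s) (der_id s)))).
  by rewrite mul0r mulr1 !add0r.
have F'E : derive1 F = cst c.
  by apply/funext => s; rewrite derive1E (@derive_val _ _ _ _ _ _ _ (dF s)).
have -> : `[a, a + c]%classic = `[F 0, F 1]%classic by rewrite /F mulr0 mulr1 addr0.
rewrite (@integration_by_substitution_increasing _ F f 0 1)//.
- by apply: eq_integral => s _; rewrite F'E /= !fctE mulrC.
- by move=> x y _ _ xy; rewrite /F ltrD2l ltr_pM2l.
- by rewrite F'E => x _; exact: cvg_cst.
- by rewrite F'E; exact: is_cvg_cst.
- by rewrite F'E; exact: is_cvg_cst.
- have cF := fun s => is_derive_continuous (dF s).
  split; first by move=> x _; case: (dF x).
    by apply: cvg_at_right_filter; exact: cF.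
  by apply: cvg_at_left_filter; exact: cF.
- by rewrite /F mulr0 mulr1 addr0; exact: continuous_seg_within.
Qed.

Lemma integral_reverse f : continuous_seg f 0 1 ->
  (\int[mu]_(t in `[0%R, 1%R]) (f t)%:E =
   \int[mu]_(s in `[0%R, 1%R]) (f (1 - s))%:E)%E.
Proof.
move=> fC; have := @integration_by_substitution_onem R f 1; rewrite unstable.onem1; apply.
  by rewrite ler01 lexx.
exact: continuous_seg_within.
Qed.

(** [F] is known on the open pieces only: at a breakpoint a path may have a corner, and its
    [derive1] is then a default value. Splitting the integral of a nonnegative function requires
    measurability, which is therefore carried through the induction. *)
Lemma piecewise_integral (F : R -> R) (k : nat) (a : nat -> R) (f : nat -> R -> R) :
  (forall t, 0 <= F t) ->
  (forall i, (i < k)%N -> a i < a i.+1) ->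
  (forall i, (i < k)%N -> continuous_seg (f i) (a i) (a i.+1)) ->
  (forall i, (i < k)%N -> forall t, a i < t < a i.+1 -> F t = f i t) ->
  (\int[mu]_(t in `[a 0%N, a k]) (F t)%:E =
   \sum_(i < k) \int[mu]_(t in `[a i, a i.+1]) (f i t)%:E)%E.
Proof.
move=> F0 a_lt fC Ff.
suff [] : measurable_fun `[a 0%N, a k] F /\
  (\int[mu]_(t in `[a 0%N, a k]) (F t)%:E =
   \sum_(i < k) \int[mu]_(t in `[a i, a i.+1]) (f i t)%:E)%E by [].
have a0k : forall j, (j <= k)%N -> a 0%N <= a j.
  elim=> [//|j IH jk]; apply: (le_trans (IH (ltnW jk))).
  exact: ltW (a_lt _ jk).
elim: {-2}k (leqnn k) => [_|j IH jk].
  rewrite big_ord0 set_itv1 integral_set1; split => //.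
  exact: measurable_fun_set1.
have [mF IF] := IH (ltnW jk); have {IH} aj := a_lt _ jk.
have mf : measurable_fun `]a j, a j.+1[ (f j).
  apply: subspace_continuous_measurable_fun => //.
  apply: continuous_in_subspaceT => t.
  rewrite inE/= in_itv/= => /andP[t1 t2]; apply: (fC _ jk).
  by rewrite !ltW.
have mFj : measurable_fun `]a j, a j.+1[ F.
  apply: eq_measurable_fun mf => t; rewrite inE/= in_itv/= => t12.
  by rewrite (Ff _ jk).
have mFoc : measurable_fun `]a j, a j.+1] F.
  exact: (@measurable_fun_itv_oc _ _ _ false true).
have E : `[a 0%N, a j.+1]%classic =
    `[a 0%N, a j]%classic `|` `]a j, a j.+1]%classic.
  by rewrite -itv_bndbnd_setU// bnd_simp ?a0k// ?ltW// ltnW.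
have mU : measurable_fun (`[a 0%N, a j]%classic `|` `]a j, a j.+1]%classic) F.
  exact/measurable_funU.
rewrite E; split => //.
rewrite ge0_integral_setU//=.
- rewrite big_ord_recr/= IF; congr (_ + _)%E.
  rewrite (@eq_integral_itv_bounded _ _ _ F (f j) true false)//; last first.
    by move=> t; rewrite in_itv/= => tj; rewrite (Ff _ jk).
  rewrite (@integral_itv_bndoo _ _ _ (EFin \o F))//; last exact/measurable_EFinP.
  by rewrite (@integral_itv_bndoo _ _ _ (EFin \o F))//; exact/measurable_EFinP.
- exact/measurable_EFinP.
- by move=> t _; rewrite lee_fin.
- apply/disj_setPS => y [/=]; rewrite 2!in_itv/= => /andP[_ yx] /andP[].
  by rewrite ltNge yx.
Qed.

End Integrals.

(** * Piecewise smooth paths *)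

Section SmoothCurves.
Variables (R : realType) (r : nat).
Implicit Types (g : R -> 'rV[R]_r) (t : R) (k : 'I_r).

Lemma is_derive_rowP g (t : R) (d : 'rV[R]_r) :
  (forall k, is_derive t 1 (fun s => g s 0 k) (d 0 k)) <-> is_derive t 1 g d.
Proof.
split=> [H|[dg <-] k].
  have dg : derivable g t 1.
    by apply/derivable_mxP => i k; rewrite (ord1 i); case: (H k).
  split=> //; rewrite derive_mx//; apply/rowP => k; rewrite mxE.
  by case: (H k).
split; first by move/derivable_mxP : dg; apply.
by rewrite derive_mx// mxE.
Qed.

Lemma smooth_curve_derive1 g : smooth_curve g -> smooth_curve (derive1 g).
Proof. by move=> sg n t; have := sg n.+1 t; rewrite /derive1n iterSr. Qed.

Lemma smooth_is_derive g t k : smooth_curve g ->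
  is_derive t 1 (fun s => g s 0 k) (derive1 g t 0 k).
Proof.
move=> sg; move: k; apply/is_derive_rowP; rewrite derive1E.
exact: derivableP (sg 0%N t).
Qed.

(** Smoothness by an invariant: a class of derivable curves stable under [derive1] contains all
    iterated derivatives of its members. *)
Lemma smooth_curve_closed (P : set (R -> 'rV[R]_r)) g :
  (forall f, P f -> (forall t, derivable f t 1) /\ P (derive1 f)) ->
  P g -> smooth_curve g.
Proof.
move=> HP Pg n; suff : P (derive1n n g) by move/HP => [].
by elim: n => //= n /HP[].
Qed.

Lemma is_derive_affine g (a c t : R) : smooth_curve g ->
  is_derive t 1 (fun s => g (a + c * s)) (c *: derive1 g (a + c * t)).
Proof.
move=> sg; apply/is_derive_rowP => k; rewrite mxE mulrC.
have d : is_derive t 1 (fun s => a + c * s) c.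
  apply: (is_derive_eq (derD (der_cst a t) (derM (der_cst c t) (der_id t)))).
  by rewrite mul0r mulr1 !add0r.
exact: (der_comp d (smooth_is_derive _ k sg)).
Qed.

Lemma derive1_affine g (a c : R) : smooth_curve g ->
  derive1 (fun s => g (a + c * s)) = fun t => c *: derive1 g (a + c * t).
Proof.
move=> sg; apply/funext => t; rewrite derive1E.
by case: (is_derive_affine a c t sg).
Qed.

Lemma smooth_curve_affine g (a c : R) : smooth_curve g ->
  smooth_curve (fun s => g (a + c * s)).
Proof.
(* The scalar [u] makes the class stable, as each derivation brings out a factor [c]. *)
move=> sg; pose P f := exists u g', smooth_curve g' /\
  f = (fun s => u *: g' (a + c * s)).
apply: (@smooth_curve_closed P); last first.
  by exists 1, g; split => //; apply/funext => s; rewrite scale1r.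
move=> _ [u [g' [sg' ->]]].
have d t : is_derive t 1 (fun s => u *: g' (a + c * s))
    ((u * c) *: derive1 g' (a + c * t)).
  by rewrite -scalerA; exact: (is_deriveZ _ (is_derive_affine a c t sg')).
split; first by move=> t; case: (d t).
exists (u * c), (derive1 g'); split; first exact: smooth_curve_derive1.
by apply/funext => t; rewrite derive1E; case: (d t).
Qed.

(** A syntactic class stable under derivation, with the operations that occur in [segment_curve]
    ([psi] of an affine function of a cosine) and in its derivatives. *)
Inductive smooth_fun : (R -> R) -> Prop :=
| sm_cst c : smooth_fun (fun=> c)
| sm_cos c : smooth_fun (fun t => cos (c * t))
| sm_sin c : smooth_fun (fun t => sin (c * t))
| sm_add f h : smooth_fun f -> smooth_fun h -> smooth_fun (fun t => f t + h t)
| sm_mul f h : smooth_fun f -> smooth_fun h -> smooth_fun (fun t => f t * h t)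
| sm_inv f : smooth_fun f -> (forall t, f t != 0) -> smooth_fun (fun t => (f t)^-1)
| sm_ln f : smooth_fun f -> (forall t, 0 < f t) -> smooth_fun (fun t => ln (f t)).

Lemma sm_derivable f : smooth_fun f -> exists2 df, smooth_fun df &
  forall t, is_derive t 1 f (df t).
Proof.
have lin (c t : R) : is_derive t 1 (fun s => c * s) c.
  by apply: (is_derive_eq (derM (der_cst c t) (der_id t))); rewrite mul0r mulr1 add0r.
elim=> {f} [c|c|c|f g sf [df sdf fD] sg [dg sdg gD]|
  f g sf [df sdf fD] sg [dg sdg gD]|f sf [df sdf fD] f0|f sf [df sdf fD] f0].
- by exists (fun=> 0) => [|t]; [exact: sm_cst|exact: der_cst].
- exists (fun t => - c * sin (c * t)).
    by apply: sm_mul; [exact: sm_cst|exact: sm_sin].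
  move=> t; apply: (is_derive_eq (der_comp (lin c t) (is_derive_cos _))).
  by rewrite mulrC mulrN mulNr.
- exists (fun t => c * cos (c * t)).
    by apply: sm_mul; [exact: sm_cst|exact: sm_cos].
  move=> t; apply: (is_derive_eq (der_comp (lin c t) (is_derive_sin _))).
  by rewrite mulrC.
- exists (fun t => df t + dg t); first exact: sm_add.
  by move=> t; exact: derD.
- exists (fun t => df t * g t + f t * dg t); first by apply: sm_add; exact: sm_mul.
  by move=> t; exact: derM.
- exists (fun t => - 1 * (df t * ((f t)^-1 * (f t)^-1))).
    apply: sm_mul; first exact: sm_cst.
    by apply: sm_mul => //; apply: sm_mul; exact: sm_inv.
  move=> t; apply: (is_derive_eq (derV (fD t) (f0 t))).
  by rewrite mulN1r expr2 invfM.
- exists (fun t => (f t)^-1 * df t).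
    by apply: sm_mul => //; apply: sm_inv => // t; rewrite gt_eqF.
  by move=> t; exact: (der_comp (fD t) (is_derive1_ln (f0 t))).
Qed.

Lemma smooth_curve_row g : (forall k, smooth_fun (fun t => g t 0 k)) ->
  smooth_curve g.
Proof.
apply: (@smooth_curve_closed (fun g => forall k, smooth_fun (fun t => g t 0 k))).
move=> {g} g sg.
have [D HD] : exists D : 'I_r -> R -> R, forall k,
    smooth_fun (D k) /\ forall t, is_derive t 1 (fun s => g s 0 k) (D k t).
  have H k : exists d, smooth_fun d /\ forall t, is_derive t 1 (fun s => g s 0 k) (d t).
    by have [d sd dD] := sm_derivable (sg k); exists d.
  by exists (fun k => projT1 (cid (H k))) => k; exact: (projT2 (cid (H k))).
have d t : is_derive t 1 g (\row_k D k t).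
  by apply/is_derive_rowP => k; rewrite mxE; case: (HD k).
split; first by move=> t; case: (d t).
move=> k; rewrite (_ : (fun t => _) = D k); first by case: (HD k).
by apply/funext => t; rewrite derive1E (@derive_val _ _ _ _ _ _ _ (d t)) mxE.
Qed.

End SmoothCurves.

(** * Lengths of paths and chains of smooth arcs *)

Lemma nondecreasing_prefix (R : realType) k (a : nat -> R) :
  (forall i, (i < k)%N -> a i < a i.+1) ->
  forall i j, (i <= j <= k)%N -> a i <= a j.
Proof.
move=> a_lt i; elim=> [|j IH] /andP[]; first by rewrite leqn0 => /eqP->.
rewrite leq_eqVlt ltnS => /predU1P[->//|ij jk].
by apply: le_trans (ltW (a_lt _ jk)); apply: IH; rewrite ij ltnW.
Qed.

Section Lengths.
Variables (R : realType) (r : nat).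
Hypothesis r2 : (2 <= r)%N.
Notation mu := (@lebesgue_measure R).
Implicit Types (g : R -> 'rV[R]_r) (x y z : 'rV[R]_r) (t : R).

Lemma metric_den_gt0 x : (forall k, 0 < x 0 k) -> 0 < metric_den x.
Proof.
move=> x0; rewrite oppr_gt0 (bigD1 (Ordinal r2))//=.
rewrite -[ltRHS]addr0 ltr_leD//; first by rewrite pmulr_llt0// dphi_lt0.
by apply: sumr_le0 => k _; rewrite pmulr_lle0// ltW// dphi_lt0.
Qed.

(** Explicit replacement for the integrand of [entropy_length]: it agrees with it inside smooth
    pieces in [M1], and its continuity is visible from the formula. *)
Definition speed g (t : R) : R := Num.sqrt (sqnorm_on_M1 (g t) (derive1 g t)).

Lemma speed_continuous g t : smooth_curve g -> M1 (g t) ->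
  {for t, continuous (speed g)}.
Proof.
move=> sg [gt0 _].
have c k := smooth_is_derive t k sg.
have c' k := smooth_is_derive t k (smooth_curve_derive1 sg).
(* Only the existence of this derivative matters, for continuity, so its value is not computed. *)
have dd k : is_derive t 1 (fun s => ddphi (g s 0 k))
    ('D_1 (fun s => ddphi (g s 0 k)) t).
  have p := der_comp (c k) (is_derive_phi _).
  apply: derivableP.
  by have [] := derM (derM (derM p (derD (der_cst 2 t) (derN p)))
   (derD (der_cst 1 t) (derN p))) (der_cst 2^-1 t).
have W := der_sum xpredT (fun k => derM (dd k) (derM (c' k) (c' k))).
have D := derN (der_sum xpredT (fun k =>
  derM (der_comp (c k) (is_derive_dphi _)) (c k))).
have D0 : - \sum_k dphi (g t 0 k) * g t 0 k != 0.
  by rewrite gt_eqF//; exact: metric_den_gt0.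
have C := is_derive_continuous (derM W (derV D D0)).
exact: (continuous_comp C (@sqrt_continuous R _)).
Qed.

Lemma speed_continuous_seg g a b : smooth_curve g ->
  (forall t, a <= t <= b -> M1 (g t)) -> continuous_seg (speed g) a b.
Proof. by move=> sg Mg t /Mg; exact: speed_continuous. Qed.

(** Around an interior [t] the sum of the [phi (g s)_k] is constantly [1]; the claim is that its
    derivative vanishes. *)
Lemma tangent_curve g a b t : smooth_curve g ->
  (forall t, a <= t <= b -> M1 (g t)) -> a < t < b ->
  \sum_k dphi (g t 0 k) * derive1 g t 0 k = 0.
Proof.
move=> sg Mg /andP[at_ tb].
have S := der_sum xpredT (fun k =>
  der_comp (smooth_is_derive t k sg) (is_derive_phi _)).
have : is_derive t 1 (fun s => \sum_k phi (g s 0 k)) 0.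
  apply: near_eq_is_derive (der_cst 1 t); near=> s.
  have /(M1P r2)[_ ->//] : M1 (g s).
  apply: Mg; apply/andP; split; apply: ltW; near: s.
    exact: lt_nbhsr.
  exact: lt_nbhsl.
by case=> _; case: S => _ -> .
Unshelve. all: by end_near. Qed.

Lemma speed_affine g (a c t : R) : smooth_curve g -> 0 <= c ->
  speed (fun s => g (a + c * s)) t = c * speed g (a + c * t).
Proof.
move=> sg c0; rewrite /speed derive1_affine//.
have -> : sqnorm_on_M1 (g (a + c * t)) (c *: derive1 g (a + c * t)) =
    c ^+ 2 * sqnorm_on_M1 (g (a + c * t)) (derive1 g (a + c * t)).
  rewrite /sqnorm_on_M1 mulrA mulr_sumr; congr (_ / _).
  by apply: eq_bigr => k _; rewrite mxE; ring.
by rewrite sqrtrM ?sqr_ge0// sqrtr_sqr ger0_norm.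
Qed.

Lemma speed_reverse g t : smooth_curve g ->
  speed (fun s => g (1 + - 1 * s)) t = speed g (1 - t).
Proof.
move=> sg; rewrite /speed derive1_affine//= mulN1r; congr Num.sqrt.
rewrite /sqnorm_on_M1; congr (_ / _).
by apply: eq_bigr => k _; rewrite mxE; ring.
Qed.

(** Inside a piece, [gamma] coincides near [t] with a smooth curve, so it has the same derivative
    there, and that derivative is tangent to [M1]. *)
Lemma entropy_lengthE (gamma : R -> 'rV[R]_r) (k : nat) (a : nat -> R)
    (g : nat -> R -> 'rV[R]_r) :
  (forall t, a 0%N <= t <= a k -> M1 (gamma t)) ->
  (forall i, (i < k)%N -> a i < a i.+1) ->
  (forall i, (i < k)%N -> smooth_curve (g i)) ->
  (forall i, (i < k)%N -> forall t, a i <= t <= a i.+1 -> gamma t = g i t) ->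
  (\int[mu]_(t in `[a 0%N, a k])
     (Num.sqrt (entropy_sqnorm (gamma t) (derive1 gamma t)))%:E =
   \sum_(i < k) \int[mu]_(t in `[a i, a i.+1]) (speed (g i) t)%:E)%E.
Proof.
move=> Mg a_lt sg gE.
have a_le := nondecreasing_prefix a_lt.
have Mgi i : (i < k)%N -> forall t, a i <= t <= a i.+1 -> M1 (g i t).
  move=> ik t /[dup] tai /andP[t1 t2]; rewrite -gE//; apply: Mg.
  apply/andP; split; first by apply: le_trans t1; apply: a_le; rewrite leq0n ltnW.
  by apply: (le_trans t2); apply: a_le; rewrite ik leqnn.
apply: (@piecewise_integral _ _ _ _ (fun i => speed (g i))) => //.
- by move=> i ik; exact: speed_continuous_seg (sg _ ik) (Mgi _ ik).
- move=> i ik t tai; have /andP[t1 t2] := tai.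
  have tai' : a i <= t <= a i.+1 by rewrite !ltW.
  rewrite /speed; congr Num.sqrt; rewrite (gE i)//.
  have -> : derive1 gamma t = derive1 (g i) t.
    rewrite !derive1E; apply: near_eq_derive; near=> s; apply: gE => //.
    apply/andP; split; apply: ltW; near: s.
      exact: lt_nbhsr.
    exact: lt_nbhsl.
  apply: entropy_sqnormE => //; first exact: Mgi.
  exact: tangent_curve (sg _ ik) (Mgi _ ik) tai.
Unshelve. all: by end_near. Qed.

Definition M1arc g x y (L : R) := [/\ smooth_curve g, g 0 = x, g 1 = y,
  forall t, 0 <= t <= 1 -> M1 (g t) &
  (\int[mu]_(t in `[0%R, 1%R]) (speed g t)%:E = L%:E)%E].

(** Piecewise smooth paths without a common parameter: every arc runs over [[0, 1]]. Concatenation,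
    reversal and additive bounds become inductions free of subdivisions. *)
Inductive chain : 'rV[R]_r -> 'rV[R]_r -> R -> Prop :=
| chain_nil x : M1 x -> chain x x 0
| chain_cons x y z g L1 L : M1arc g x y L1 -> chain y z L -> chain x z (L1 + L).

Lemma chain_cat x y z L1 L2 : chain x y L1 -> chain y z L2 -> chain x z (L1 + L2).
Proof.
move=> c; elim: c L2 => {x y L1} [x _ L2|x y w g L1 L gxy _ IH L2 wz].
  by rewrite add0r.
by rewrite -addrA; apply: chain_cons gxy _; exact: IH.
Qed.

Lemma arc_M1 g x y L : M1arc g x y L -> M1 x /\ M1 y.
Proof. by case=> _ <- <- Mg _; split; apply: Mg; rewrite lexx ler01. Qed.

Lemma arc_chain g x y L : M1arc g x y L -> chain x y L.
Proof.
move=> gxy; rewrite -[L]addr0; apply: (chain_cons gxy).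
by apply: chain_nil; case: (arc_M1 gxy).
Qed.

Lemma arc_reverse g x y L : M1arc g x y L -> M1arc (fun s => g (1 + - 1 * s)) y x L.
Proof.
move=> [sg g0 g1 Mg gL]; split.
- exact: smooth_curve_affine.
- by rewrite mulr0 addr0.
- by rewrite mulr1 subrr.
- by move=> t /andP[t0 t1]; apply: Mg; apply/andP; split; lra.
- rewrite -gL [RHS]integral_reverse; last exact: speed_continuous_seg.
  by apply: eq_integral => t _; rewrite speed_reverse.
Qed.

Lemma chain_reverse x y L : chain x y L -> chain y x L.
Proof.
elim=> {x y L} [x Mx|x y z g L1 L gxy _ IH]; first exact: chain_nil.
by rewrite addrC; apply: chain_cat IH _; exact: arc_chain (arc_reverse gxy).
Qed.

Lemma arc_rescale g a b : a < b -> smooth_curve g ->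
  (forall t, a <= t <= b -> M1 (g t)) ->
  exists2 L, (\int[mu]_(t in `[a, b]) (speed g t)%:E = L%:E)%E &
  M1arc (fun s => g (a + (b - a) * s)) (g a) (g b) L.
Proof.
move=> ab sg Mg; have ba : 0 < b - a by rewrite subr_gt0.
have gC := speed_continuous_seg sg Mg.
have [G [_ _ GE]] := continuous_seg_primitive ab gC.
exists (G b - G a); first exact: GE.
have bE : a + (b - a) = b by rewrite addrC subrK.
split.
- exact: smooth_curve_affine.
- by rewrite mulr0 addr0.
- by rewrite mulr1 bE.
- move=> t /andP[t0 t1]; apply: Mg; apply/andP; split; first by rewrite lerDl mulr_ge0// ltW.
  by rewrite -lerBrDl ler_piMr// ltW.
- have := @integral_affine _ (speed g) a (b - a) ba; rewrite bE => /(_ gC) E.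
  rewrite -GE E; apply: eq_integral => t _.
  by rewrite (speed_affine _ _ sg (ltW ba)).
Qed.

Lemma ps_path_chain gamma x y : ps_path_in_M1 gamma x y ->
  exists2 L, chain x y L & entropy_length gamma = L%:E.
Proof.
move=> [g0 g1 Mg [k [a [g [a0 ak a_lt sg gE]]]]].
have a_le := nondecreasing_prefix a_lt.
have Mgi i : (i < k)%N -> forall t, a i <= t <= a i.+1 -> M1 (g i t).
  move=> ik t /[dup] tai /andP[t1 t2]; rewrite -gE//; apply: Mg.
  rewrite -a0 -ak.
  apply/andP; split; first by apply: le_trans t1; apply: a_le; rewrite leq0n ltnW.
  by apply: (le_trans t2); apply: a_le; rewrite ik leqnn.
have := @entropy_lengthE gamma k a g; rewrite a0 ak => /(_ Mg a_lt sg gE) lE.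
rewrite /entropy_length lE.
have {1}<- : gamma (a 0%N) = x by rewrite a0.
have <- : gamma (a k) = y by rewrite ak.
suff : forall j, (j <= k)%N -> exists2 L, chain (gamma (a 0%N)) (gamma (a j)) L &
    (\sum_(i < j) \int[mu]_(t in `[a i, a i.+1]) (speed (g i) t)%:E = L%:E)%E.
  by apply.
elim=> [_|j IH jk].
  exists 0; last by rewrite big_ord0.
  by apply: chain_nil; apply: Mg; rewrite a0 lexx ler01.
have [L c LE] := IH (ltnW jk).
have [L1 L1E arcj] := arc_rescale (a_lt _ jk) (sg _ jk) (Mgi _ jk).
exists (L + L1); last by rewrite big_ord_recr/= LE L1E.
have aj := ltW (a_lt _ jk).
by apply: (chain_cat c); rewrite !(gE j jk) ?lexx ?aj//; exact: arc_chain arcj.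
Qed.

(** The interval is arbitrary for the sake of the induction: the first arc is run over the left half
    and the remaining chain over the right half. *)
Lemma chain_pieces x y L : chain x y L -> forall a b, a < b ->
  exists (gamma : R -> 'rV[R]_r) (k : nat) (c : nat -> R)
    (g : nat -> R -> 'rV[R]_r),
  [/\ gamma a = x /\ gamma b = y, (forall t, a <= t <= b -> M1 (gamma t)),
    [/\ c 0%N = a, c k = b, forall i, (i < k)%N -> c i < c i.+1,
      forall i, (i < k)%N -> smooth_curve (g i) &
      forall i, (i < k)%N -> forall t, c i <= t <= c i.+1 -> gamma t = g i t] &
    (\sum_(i < k) \int[mu]_(t in `[c i, c i.+1]) (speed (g i) t)%:E = L%:E)%E].
Proof.
elim=> {x y L} [x Mx a b ab|x y z g L1 L gxy _ IH a b ab].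
  (* A chain without arcs still needs one piece to cover [[a, b]]: a constant curve, of length
     [0]. *)
  exists (fun=> x), 1%N, (fun i => if i is 0%N then a else b), (fun _ _ => x).
  have sx : smooth_curve (fun _ : R => x).
    by apply: smooth_curve_row => k; exact: sm_cst.
  split=> //; first by split=> // [[]].
  rewrite big_ord1/= integral0_eq// => t _; congr EFin.
  rewrite /speed /sqnorm_on_M1 big1 ?mul0r ?sqrtr0// => k _.
  by rewrite derive1_cst mxE expr0n mulr0.
have [sg g0 g1 Mg gL] := gxy.
pose m := (a + b) / 2; have am : a < m by rewrite /m; lra.
have mb : m < b by rewrite /m; lra.
have [gam [k [c [gs [[gamm gamb] Mgam [c0 ck c_lt sgs gE] cL]]]]] := IH m b mb.
pose u := (m - a)^-1; have u0 : 0 < u by rewrite invr_gt0 subr_gt0.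
pose g' s := g (- (u * a) + u * s).
have sg' : smooth_curve g' by exact: smooth_curve_affine.
have g'a : g' a = x by rewrite /g' addrC subrr.
have g'm : g' m = y.
  by rewrite /g' addrC -mulrBr mulVf// subr_eq0 gt_eqF.
have Mg' t : a <= t <= m -> M1 (g' t).
  move=> /andP[t1 t2]; apply: Mg; rewrite addrC -mulrBr; apply/andP; split.
    by rewrite mulr_ge0 ?(ltW u0)// subr_ge0.
  by rewrite /u mulrC ler_pdivrMr ?subr_gt0// mul1r lerD2r.
exists (fun t => if t <= m then g' t else gam t), k.+1,
  (fun i => if i is j.+1 then c j else a), (fun i => if i is j.+1 then gs j else g').
split.
- by rewrite (ltW am) leNgt mb/=.
- move=> t /andP[t1 t2]; case: ifPn => [tm|]; first by apply: Mg'; rewrite t1.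
  by rewrite -ltNge => mt; apply: Mgam; rewrite t2 ltW.
- split; [by []|exact: ck| | |].
  + by case=> [_|i]; [rewrite c0|exact: c_lt].
  + by case=> [_|i]; [exact: sg'|exact: sgs].
  + case=> [_ t|i ik t]; first by rewrite c0 => /andP[_ ->].
    have mci : forall j, (j <= k)%N -> m <= c j.
      elim=> [|j IHj jk]; first by rewrite c0.
      by rewrite (le_trans (IHj (ltnW jk)))// ltW// c_lt.
    (* On a later piece [t <= m] forces [t = m], where both curves pass through [y]. *)
    move=> /= tc; case: ifPn => [tm|_]; last exact: gE.
    have tE : t = m.
      by apply/eqP; rewrite eq_le tm/= (le_trans (mci i (ltnW ik)))//; case/andP: tc.
    by rewrite -(gE i)// tE g'm gamm.
- rewrite big_ord_recl/= c0; under eq_bigr do rewrite /= .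
  rewrite cL EFinD; congr (_ + _)%E.
  have [L' -> [_ _ _ _ <-]] := arc_rescale am sg' Mg'.
  rewrite -gL; apply: eq_integral => t _; congr EFin; congr (speed _ t).
  apply/funext => s; rewrite /g'; congr (g _).
  by rewrite /u; field; rewrite subr_eq0 gt_eqF.
Qed.

Lemma chain_ps_path x y L : chain x y L ->
  exists2 gamma, ps_path_in_M1 gamma x y & entropy_length gamma = L%:E.
Proof.
move=> /chain_pieces /(_ 0 1 ltr01)[gamma [k [c [g [[g0 g1] Mg [c0 ck c_lt sg gE] cL]]]]].
exists gamma; first by split=> //; exists k, c, g.
have := @entropy_lengthE gamma k c g; rewrite c0 ck => /(_ Mg c_lt sg gE) lE.
by rewrite -cL -lE.
Qed.

(** Paths and chains realise the same lengths, so bounds can be proved for single arcs and added up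
    along chains. *)
Lemma entropy_distE x y :
  entropy_dist x y = ereal_inf [set L%:E | L in chain x y].
Proof.
congr ereal_inf; apply/seteqP; split => [_ [gamma /ps_path_chain[L cL ->] <-]|].
  by exists L.
by move=> _ [L /chain_ps_path[gamma pg gL] <-]; exists gamma.
Qed.

End Lengths.

(** * The metric in simplex coordinates *)

Lemma ln_le_sub1 (R : realType) (x : R) : 0 < x -> ln x <= x - 1.
Proof.
move=> x0; have := @le_ln1Dx R (x - 1).
by rewrite (addrC 1) subrK; apply; lra.
Qed.

(** Weighted Cauchy-Schwarz inequality: expand the nonnegative sum of
    [(q k - Q / P * p k) ^ 2 / p k]. If [P = 0] then [A] is empty. *)
Lemma sqr_sum_le (R : realType) (I : finType) (A : pred I) (p q : I -> R) :
  (forall k, 0 < p k) ->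
  (\sum_(k | A k) q k) ^+ 2 <=
  (\sum_(k | A k) p k) * \sum_(k | A k) q k ^+ 2 / p k.
Proof.
move=> p0; set P := \sum_(k | A k) p k; set Q := \sum_(k | A k) q k.
set S := \sum_(k | A k) _.
have P0 : 0 <= P by apply: sumr_ge0 => k _; exact: ltW.
have [PE|Pn0] := eqVneq P 0.
  have Ak k : A k -> False.
    move=> ak; have : 0 < P.
      rewrite /P (bigD1 k)//= ltr_pwDl//; apply: sumr_ge0 => j _; exact: ltW.
    by rewrite PE ltxx.
  by rewrite /Q big1 ?expr0n ?mul0r ?PE ?mul0r// => k /Ak.
have Pgt : 0 < P by rewrite lt_neqAle eq_sym Pn0.
have : 0 <= \sum_(k | A k) (q k - Q / P * p k) ^+ 2 / p k.
  by apply: sumr_ge0 => k _; rewrite divr_ge0 ?sqr_ge0// ltW.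
have -> : \sum_(k | A k) (q k - Q / P * p k) ^+ 2 / p k = S - Q ^+ 2 / P.
  transitivity (S - 2 * (Q / P) * Q + (Q / P) ^+ 2 * P); last by field.
  rewrite /S {2}/Q /P !mulr_sumr -sumrB -big_split/=.
  apply: eq_bigr => k _; rewrite -/P -/Q; field.
  by rewrite Pn0/= gt_eqF.
by rewrite subr_ge0 ler_pdivrMr// mulrC.
Qed.

Section Pointwise.
Variables (R : realType) (r : nat) (p q : 'I_r -> R).
Hypothesis r2 : (2 <= r)%N.
Hypothesis p0 : forall k, 0 < p k.
Hypothesis p1 : \sum_k p k = 1.
Hypothesis q0 : \sum_k q k = 0.

(* The squared norm of the velocity [q] at the point [p] is [metric_num / metric_den_sum]. *)
Definition metric_weight (x : R) : R := 2 * (1 - x) / (x * (2 - x)).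
Definition metric_num : R := \sum_k metric_weight (p k) * q k ^+ 2.
Definition metric_den_term (x : R) : R := x * (2 - x) / 2 * psi x.
Definition metric_den_sum : R := \sum_k metric_den_term (p k).

Lemma sum_others i : \sum_(k | k != i) p k = 1 - p i.
Proof. by rewrite -p1 [in RHS](bigD1 i)//= addrAC subrr add0r. Qed.

Lemma simplex_lt1 i : p i < 1.
Proof.
have [j ji] : exists j : 'I_r, j != i.
  apply/existsP; rewrite -[X in is_true X]negbK; apply/negP => /existsPn H.
  have : (#|'I_r| <= #|pred1 i|)%N.
    by apply/subset_leq_card/fintype.subsetP => j _; have := H j; rewrite negbK.
  by rewrite card1 card_ord leqNgt r2.
rewrite -subr_gt0 -sum_others (bigD1 j)//= ltr_pwDl//.
by apply: sumr_ge0 => k _; exact: ltW.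
Qed.

Let p1' := simplex_lt1.

Lemma metric_weight_ge0 i : 0 <= metric_weight (p i).
Proof.
have := p0 i; have := p1' i => *.
by rewrite /metric_weight divr_ge0 ?mulr_ge0//; lra.
Qed.

Lemma metric_num_term_ge0 i : 0 <= metric_weight (p i) * q i ^+ 2.
Proof. by rewrite mulr_ge0 ?metric_weight_ge0 ?sqr_ge0. Qed.

Lemma metric_num_ge0 : 0 <= metric_num.
Proof. by apply: sumr_ge0 => k _; exact: metric_num_term_ge0. Qed.

Lemma metric_den_term_gt0 i : 0 < metric_den_term (p i).
Proof.
have a := p0 i; have b := p1' i.
by rewrite mulr_gt0 ?psi_gt0 ?a// divr_gt0// mulr_gt0//; lra.
Qed.

(** [ln y <= y - 1] at [y = (2 - p i) / p i]. The factor [1 - p i] records that the term vanishes at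
    a vertex. *)
Lemma metric_den_term_le i : metric_den_term (p i) <= (2 - p i) * (1 - p i).
Proof.
have a := p0 i; have b := p1' i.
have x0 : 0 < (2 - p i) / p i by rewrite divr_gt0//; lra.
apply: (@le_trans _ _ (p i * (2 - p i) / 2 * ((2 - p i) / p i - 1))).
  rewrite ler_wpM2l ?ln_le_sub1// divr_ge0// mulr_ge0//; lra.
by rewrite le_eqVlt; apply/orP; left; apply/eqP; field; rewrite gt_eqF.
Qed.

Lemma metric_den_sum_gt0 : 0 < metric_den_sum.
Proof.
rewrite /metric_den_sum (bigD1 (Ordinal r2))//= ltr_pwDl ?metric_den_term_gt0//.
by apply: sumr_ge0 => *; exact: ltW (metric_den_term_gt0 _).
Qed.

Lemma metric_den_term_le_sum i : metric_den_term (p i) <= metric_den_sum.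
Proof.
rewrite /metric_den_sum (bigD1 i)//= lerDl.
by apply: sumr_ge0 => *; exact: ltW (metric_den_term_gt0 _).
Qed.

Lemma metric_den_sum_le : metric_den_sum <= 2 * r%:R.
Proof.
apply: (@le_trans _ _ (\sum_(k < r) 2)); last first.
  by rewrite sumr_const card_ord -[leLHS]mulr_natr.
apply: ler_sum => k _; apply: (le_trans (metric_den_term_le k)).
by have := p0 k; have := p1' k; nra.
Qed.

(** On [(0, 1/2]] the weight is at least [1], because [x (2 - x) <= 2 (1 - x)] there. *)
Lemma sqr_velocity_le_half i : p i <= 2^-1 -> q i ^+ 2 <= metric_num.
Proof.
move=> pi; rewrite /metric_num (bigD1 i)//=.
apply: (@le_trans _ _ (metric_weight (p i) * q i ^+ 2)); last first.
  by rewrite lerDl; apply: sumr_ge0 => *; exact: metric_num_term_ge0.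
rewrite ler_peMl ?sqr_ge0// /metric_weight ler_pdivlMr.
  by have := p0 i; nra.
by have := p0 i => ?; rewrite mulr_gt0//; lra.
Qed.

(** The weight of coordinate [i] degenerates as [p i] tends to [1], so [q i] is controlled through
    the others: it is minus their sum, and Cauchy-Schwarz gives the factor [1 - p i]. The other
    coordinates are at most [1/2], where [1 / x] is at most [3/2] of the weight. *)
Lemma sqr_velocity_ge_half i : 2^-1 <= p i ->
  q i ^+ 2 <= 3 / 2 * (1 - p i) * metric_num.
Proof.
move=> pi; have a := p1' i.
have -> : q i ^+ 2 = (\sum_(k | k != i) q k) ^+ 2.
  by move: q0; rewrite (bigD1 i)//= => /eqP; rewrite addr_eq0 => /eqP ->; rewrite sqrrN.
apply: (le_trans (sqr_sum_le _ _ p0)); rewrite sum_others mulrAC mulrC.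
rewrite ler_wpM2r//; first by lra.
rewrite mulr_sumr [leRHS](bigD1 i)//=.
have i0 : 0 <= 3 / 2 * (metric_weight (p i) * q i ^+ 2).
  by rewrite mulr_ge0 ?metric_num_term_ge0//; lra.
apply: (@le_trans _ _ (\sum_(k | k != i) 3 / 2 * (metric_weight (p k) * q k ^+ 2))); last by rewrite lerDr.
apply: ler_sum => k ki.
have pk : p k <= 2^-1.
  have : p k <= \sum_(k | k != i) p k.
    by rewrite (bigD1 k)//= lerDl; apply: sumr_ge0 => *; exact: ltW.
  by rewrite sum_others; lra.
have pk0 := p0 k.
rewrite mulrA mulrC ler_wpM2r ?sqr_ge0// /metric_weight.
rewrite -subr_ge0.
have -> : 3 / 2 * (2 * (1 - p k) / (p k * (2 - p k))) - (p k)^-1 =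
  (1 - 2 * p k) / (p k * (2 - p k)).
  have p2 : 0 < 2 - p k by lra.
  by field; rewrite (gt_eqF pk0) (gt_eqF p2).
by rewrite divr_ge0 ?mulr_ge0//; lra.
Qed.

Lemma sqr_velocity_le i : q i ^+ 2 <= metric_num.
Proof.
have [/sqr_velocity_le_half//|/ltW pi] := leP (p i) 2^-1.
apply: (le_trans (sqr_velocity_ge_half pi)).
by rewrite ler_piMl ?metric_num_ge0//; have := p1' i; lra.
Qed.

(** From [q_i ^ 2 <= metric_num] and [metric_den_sum <= 2 r <= (2 r) ^ 2]. *)
Lemma coordinate_speed i : `|q i / (2 * r%:R)| <= Num.sqrt (metric_num / metric_den_sum).
Proof.
have r2R : 2 <= r%:R :> R by rewrite ler_nat.
rewrite -sqrtr_sqr ler_wsqrtr// ler_pdivlMr ?metric_den_sum_gt0//.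
have qw := sqr_velocity_le i; have D := metric_den_sum_le; have D0 := metric_den_sum_gt0.
rewrite exprMn -mulrA -[leRHS]mulr1 ler_pM ?sqr_ge0//.
  by rewrite mulr_ge0 ?sqr_ge0// ltW.
rewrite exprVn mulrC ler_pdivrMr ?mul1r ?exprn_gt0//; last by lra.
by apply: (le_trans D); nra.
Qed.

(* With [e := 1 - p i], [p k ln (2 / p k) <= e - p k ln e] by [ln x <= x - 1]
   applied to [x = e / p k]. *)
Lemma metric_den_sum_le_near_vertex i : 2^-1 <= p i ->
  metric_den_sum <= (1 - p i) * (r.+1%:R - ln (1 - p i)).
Proof.
move=> pi; set e := 1 - p i; have pi1 := p1' i.
have e0 : 0 < e by rewrite /e; lra.
have others k : k != i -> metric_den_term (p k) <= e - p k * ln e.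
  move=> ki; have pk0 := p0 k; have pk1 := p1' k.
  apply: (@le_trans _ _ (p k * psi (p k))).
    rewrite ler_wpM2r ?(ltW (psi_gt0 _)) ?pk0//.
    by rewrite ler_pdivrMr// ler_pM2l//; lra.
  (* The estimate [ln (2 - p k) <= 1] is exactly offset by the [- 1] in the bound for
     [ln (e / p k)]. *)
  apply: (@le_trans _ _ (p k * ((2 - 1) + (e / p k - 1) - ln e))); last first.
    rewrite le_eqVlt; apply/orP; left; apply/eqP; field.
    by rewrite gt_eqF.
  rewrite ler_pM2l//.
  have -> : psi (p k) = ln (2 - p k) + ln (e / p k) - ln e.
    rewrite /psi !ln_div ?posrE//; first by ring.
    by lra.
  have ep : 0 < e / p k by rewrite divr_gt0.
  have := ln_le_sub1 ep; have p2 : 0 < 2 - p k by lra.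
  by have := ln_le_sub1 p2; lra.
rewrite /metric_den_sum (bigD1 i)//=.
have h1 : metric_den_term (p i) <= 2 * e.
  apply: (le_trans (metric_den_term_le i)); rewrite -[1 - p i]/e ler_wpM2r ?(ltW e0)//.
  by have := p0 i; lra.
have h2 : \sum_(k | k != i) metric_den_term (p k) <= (r%:R - 1) * e - e * ln e.
  apply: (le_trans (ler_sum _ others)).
  rewrite sumrB -mulr_suml sum_others -/e lerD2r.
  have : \sum_(k < r) (1 : R) = r%:R by rewrite sumr_const card_ord.
  rewrite (bigD1 i)//= => <-; rewrite addrAC subrr add0r mulr_suml.
  by under [leRHS]eq_bigr do rewrite mul1r.
apply: (le_trans (lerD h1 h2)); rewrite -natr1.
by rewrite le_eqVlt; apply/orP; left; apply/eqP; ring.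
Qed.

(** One formula serves all of [(0, 1)]. For [p i >= 1/2] both the squared velocity and the
    denominator carry a factor [e], and [3/2 <= K] absorbs the constant. For [p i < 1/2] the
    constant [2 * r.+1%:R] gives [e * K >= r + 1], whose square exceeds the global bound [2 r] on
    the denominator. *)
Lemma vertex_speed i :
  `|q i / ((1 - p i) * (2 * r.+1%:R - ln (1 - p i)))| <= Num.sqrt (metric_num / metric_den_sum).
Proof.
have r2R : 2 <= r%:R :> R by rewrite ler_nat.
have a := p0 i; have b := p1' i.
have W0 := metric_num_ge0; have D0 := metric_den_sum_gt0.
set e := 1 - p i; set K := 2 * r.+1%:R - ln e.
have e0 : 0 < e by rewrite /e; lra.
have ln0 : ln e <= 0 by rewrite ln_le0// /e; lra.
have KE : K = 2 * r%:R + 2 - ln e by rewrite /K -natr1; ring.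
have K6 : 2 * r%:R + 2 <= K by rewrite KE; lra.
have K0 : 0 < K by lra.
rewrite -sqrtr_sqr ler_wsqrtr// exprMn exprVn ler_pdivlMr// mulrAC.
rewrite ler_pdivrMr ?exprn_gt0 ?mulr_gt0//.
have [pi|pi] := leP 2^-1 (p i).
  have DK : metric_den_sum <= e * K.
    apply: (le_trans (metric_den_sum_le_near_vertex pi)); rewrite -/e ler_pM2l//.
    by rewrite KE -natr1; lra.
  apply: (@le_trans _ _ (3 / 2 * e * metric_num * (e * K))).
    by rewrite ler_pM ?sqr_ge0 ?(ltW D0)// sqr_velocity_ge_half.
  have -> : metric_num * (e * K) ^+ 2 = (K * e * metric_num) * (e * K) by ring.
  rewrite ler_wpM2r ?mulr_ge0 ?(ltW e0) ?(ltW K0)//.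
  rewrite -[leLHS]mulrA -[leRHS]mulrA ler_wpM2r ?mulr_ge0 ?(ltW e0)//.
  by lra.
have qw := sqr_velocity_le i; have D := metric_den_sum_le.
rewrite ler_pM ?sqr_ge0 ?(ltW D0)//.
apply: (le_trans D).
have : r%:R + 1 <= e * K by have : 2^-1 <= e; [rewrite /e; lra|nra].
by nra.
Qed.

(** The weight is at most [2 / x], the denominator at least [c], and the root of a sum of squares at
    most the sum. Each term is, up to a constant, the derivative of a [sqrt (p k)]. *)
Lemma speed_le_sum i (c : R) : 0 < c -> c <= metric_den_term (p i) ->
  Num.sqrt (metric_num / metric_den_sum) <=
  \sum_k Num.sqrt (2 / c) * (`|q k| / Num.sqrt (p k)).
Proof.
move=> c0 cD; pose X k := Num.sqrt (2 / c) * (`|q k| / Num.sqrt (p k)).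
change (Num.sqrt (metric_num / metric_den_sum) <= \sum_k X k).
have X0 k : 0 <= X k.
  by rewrite mulr_ge0 ?sqrtr_ge0// divr_ge0// sqrtr_ge0.
have S0 : 0 <= \sum_k X k by apply: sumr_ge0.
rewrite -[leRHS]ger0_norm// -sqrtr_sqr ler_wsqrtr//.
apply: (@le_trans _ _ (\sum_k X k ^+ 2)); last first.
  rewrite expr2 mulr_suml; apply: ler_sum => k _.
  rewrite expr2 ler_wpM2l// (bigD1 k)//= lerDl.
  by apply: sumr_ge0.
rewrite /metric_num mulr_suml; apply: ler_sum => k _.
have pk := p0 k; have pk1 := p1' k.
rewrite /X !exprMn exprVn !sqr_sqrtr ?divr_ge0 ?(ltW c0) ?(ltW pk)//.
rewrite real_normK ?num_real//.
have -> : 2 / c * (q k ^+ 2 / p k) = (2 / p k) * q k ^+ 2 / c.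
  by field; rewrite !gt_eqF.
apply: ler_pM; rewrite ?metric_num_term_ge0 ?invr_ge0 ?(ltW metric_den_sum_gt0)//.
  rewrite ler_wpM2r ?sqr_ge0// /metric_weight -subr_ge0.
  have -> : 2 / p k - 2 * (1 - p k) / (p k * (2 - p k)) = 2 / (p k * (2 - p k)).
    have p2 : 0 < 2 - p k by lra.
    by field; rewrite (gt_eqF pk) (gt_eqF p2).
  by rewrite divr_ge0// mulr_ge0//; lra.
by rewrite lef_pV2 ?posrE ?metric_den_sum_gt0// (le_trans cD)// metric_den_term_le_sum.
Qed.

End Pointwise.

(** * Lower and upper bounds for lengths *)

Section SimplexCoordinates.
Variables (R : realType) (r : nat).
Hypothesis r2 : (2 <= r)%N.
Notation mu := (@lebesgue_measure R).
Implicit Types (g : R -> 'rV[R]_r) (x y z P Q : 'rV[R]_r) (t : R) (k : 'I_r).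

Definition simplex_coord x : 'rV[R]_r := \row_k phi (x 0 k).
Definition length_coord P : 'rV[R]_r := \row_k psi (P 0 k).

Definition open_simplex : set 'rV[R]_r :=
  [set P | (forall k, 0 < P 0 k) /\ \sum_k P 0 k = 1].

Lemma open_simplex_lt1 P k : open_simplex P -> P 0 k < 1.
Proof. by move=> [P0 P1]; exact: (@simplex_lt1 _ _ (fun k => P 0 k)). Qed.

Lemma simplex_coord_M1 x : M1 x -> open_simplex (simplex_coord x).
Proof.
move=> /(M1P r2)[x0 x1]; split=> [k|]; first by rewrite mxE phi_gt0.
by rewrite -x1; apply: eq_bigr => k _; rewrite mxE.
Qed.

Lemma phi_length_coord P k : open_simplex P -> phi (length_coord P 0 k) = P 0 k.
Proof.
move=> oP; rewrite mxE psiK//.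
by have := open_simplex_lt1 k oP; case: oP => /(_ k) -> _ /=; lra.
Qed.

Lemma length_coord_M1 P : open_simplex P -> M1 (length_coord P).
Proof.
move=> oP; apply/(M1P r2); split=> [k|].
  by rewrite -phi_lt1 phi_length_coord// open_simplex_lt1.
by case: (oP) => _ <-; apply: eq_bigr => k _; rewrite phi_length_coord.
Qed.

Lemma simplex_coordK x : length_coord (simplex_coord x) = x.
Proof. by apply/rowP => k; rewrite !mxE phiK. Qed.

Lemma length_coordK P : open_simplex P -> simplex_coord (length_coord P) = P.
Proof. by move=> oP; apply/rowP => k; rewrite mxE phi_length_coord. Qed.

Definition pos_of g t : 'I_r -> R := fun k => phi (g t 0 k).
Definition vel_of g t : 'I_r -> R := fun k => dphi (g t 0 k) * derive1 g t 0 k.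

Lemma is_derive_pos g t k : smooth_curve g ->
  is_derive t 1 (fun s => pos_of g s k) (vel_of g t k).
Proof.
by move=> sg; exact: (der_comp (smooth_is_derive t k sg) (is_derive_phi _)).
Qed.

(** The velocity in simplex coordinates is [dphi] times the velocity of the lengths, and [ddphi]
    equals [metric_weight (phi)] times [dphi ^ 2]. *)
Lemma speedE g t : speed g t =
  Num.sqrt (metric_num (pos_of g t) (vel_of g t) / metric_den_sum (pos_of g t)).
Proof.
congr Num.sqrt; rewrite /sqnorm_on_M1; congr (_ / _).
  apply: eq_bigr => k _; rewrite /metric_weight /vel_of /pos_of /dphi /ddphi.
  set p := phi _; have p0 : 0 < p by exact: phi_gt0.
  have p2 : 0 < 2 - p by rewrite subr_gt0; exact: phi_lt2.
  by field; rewrite (gt_eqF p0) (gt_eqF p2).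
rewrite /metric_den -sumrN; apply: eq_bigr => k _.
by rewrite /metric_den_term /pos_of phiK /dphi; ring.
Qed.

(** * Lower bounds from functions of one coordinate *)

Section LowerBound.
Variables (F dF : R -> R) (i : 'I_r).
Hypothesis F_derive : forall p : R, 0 < p < 1 -> is_derive p 1 F (dF p).
Hypothesis F_speed : forall p q : 'I_r -> R, (forall k, 0 < p k) ->
  \sum_k p k = 1 -> \sum_k q k = 0 ->
  `|dF (p i) * q i| <= Num.sqrt (metric_num p q / metric_den_sum p).

(** The derivative of [F (p_i)] along the arc is at most the speed in absolute value; integrating
    this for [F] and for [- F] gives the two signs. *)
Lemma arc_increment g x y L : M1arc g x y L ->
  `|F (phi (y 0 i)) - F (phi (x 0 i))| <= L.
Proof.
move=> [sg <- <- Mg gL].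
have sgC := speed_continuous_seg r2 sg Mg.
have posP t : 0 <= t <= 1 -> (forall k, 0 < pos_of g t k) /\ \sum_k pos_of g t k = 1.
  by move=> /Mg/(M1P r2)[_ s1]; split=> // k; exact: phi_gt0.
have dH t : 0 <= t <= 1 -> is_derive t 1 (fun s => F (pos_of g s i))
    (dF (pos_of g t i) * vel_of g t i).
  move=> t01; apply: (der_comp (is_derive_pos t i sg)).
  have [p0 p1] := posP _ t01; apply: F_derive.
  by rewrite p0/=; exact: (simplex_lt1 r2 p0 p1).
have bound t : 0 < t < 1 ->
    `|dF (pos_of g t i) * vel_of g t i| <= speed g t.
  move=> t01; have [p0 p1] : (forall k, 0 < pos_of g t k) /\ \sum_k pos_of g t k = 1.
    by apply: posP; case/andP : t01 => *; rewrite !ltW.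
  by rewrite speedE; apply: F_speed => //; exact: (tangent_curve r2 sg Mg t01).
rewrite ler_norml; apply/andP; split; rewrite -lee_fin.
  rewrite EFinN leeNl -EFinN opprB -gL.
  have -> : F (phi (g 0 0 i)) - F (phi (g 1 0 i)) =
    (fun t => - F (pos_of g t i)) 1 - (fun t => - F (pos_of g t i)) 0.
    by rewrite /= opprK addrC.
  apply: (@increment_le_integral R (speed g) (fun t => - F (pos_of g t i))
     (fun t => - (dF (pos_of g t i) * vel_of g t i)) 0 1) => //.
    by move=> t /dH; exact: derN.
  by move=> t /bound; rewrite ler_norml lerNl => /andP[].
rewrite -gL; apply: (@increment_le_integral R (speed g) (fun t => F (pos_of g t i))
     (fun t => dF (pos_of g t i) * vel_of g t i) 0 1) => //.
by move=> t /bound; rewrite ler_norml => /andP[].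
Qed.

Lemma chain_increment x y L : chain x y L ->
  `|F (phi (y 0 i)) - F (phi (x 0 i))| <= L.
Proof.
elim=> {x y L} [x _|x y z g L1 L /arc_increment h1 _ h2].
  by rewrite subrr normr0.
apply: le_trans (lerD h1 h2); apply: le_trans (ler_normD _ _).
by rewrite [X in _ <= `|X|]addrC subrKA.
Qed.

End LowerBound.

Lemma chain_coord x y L k : chain x y L ->
  `|phi (y 0 k) - phi (x 0 k)| <= 2 * r%:R * L.
Proof.
have r0 : 0 < 2 * r%:R :> R.
  by rewrite mulr_gt0// ltr0n ltnW.
pose F (p : R) := p * (2 * r%:R)^-1.
move=> /(@chain_increment F (fun=> (2 * r%:R)^-1) k) H.
rewrite mulrC -ler_pdivrMr// -[X in _ / X]gtr0_norm// -normf_div mulrBl; apply: H.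
  move=> p _; apply: (is_derive_eq (derM (der_id p) (der_cst _ p))).
  by rewrite mul1r mulr0 addr0.
by move=> p q p0 p1 q0; rewrite mulrC; exact: coordinate_speed.
Qed.

(** Primitive of the factor of [q i] in [vertex_speed]; it tends to infinity as [p] tends to [1]. *)
Definition vertex_depth (p : R) : R := ln (2 * r.+1%:R - ln (1 - p)).

Lemma chain_vertex_depth x y L k : chain x y L ->
  `|vertex_depth (phi (y 0 k)) - vertex_depth (phi (x 0 k))| <= L.
Proof.
apply: (@chain_increment vertex_depth
  (fun p => ((1 - p) * (2 * r.+1%:R - ln (1 - p)))^-1)); last first.
  by move=> p q p0 p1 q0; rewrite mulrC; exact: vertex_speed.
move=> p /andP[p0 p1]; have e0 : 0 < 1 - p by rewrite subr_gt0.
have ln0 : ln (1 - p) <= 0 by rewrite ln_le0// gerBl ltW.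
have K0 : 0 < 2 * r.+1%:R - ln (1 - p).
  by rewrite subr_gt0 (le_lt_trans ln0)// mulr_gt0.
have d1 := derD (der_cst (1:R) p) (derN (der_id p)).
have d2 := derD (der_cst (2 * r.+1%:R) p) (derN (der_comp d1 (is_derive1_ln e0))).
apply: (is_derive_eq (der_comp d2 (is_derive1_ln K0))).
move: (2 * r.+1%:R) K0 => K K0; field.
by rewrite (gt_eqF e0) (gt_eqF K0).
Qed.

Lemma chain_ge0 x y L : chain x y L -> 0 <= L.
Proof.
by move=> /(chain_vertex_depth (Ordinal r2)); exact: le_trans.
Qed.

(** * Upper bounds from straight segments of the simplex *)

Section Segment.
Variables (P Q : 'rV[R]_r).
Hypotheses (oP : open_simplex P) (oQ : open_simplex Q).

(* A smooth monotone reparametrisation of [0, 1] with values in [0, 1] on the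
   whole line, so that the segment extends to a smooth curve on the line. *)
Definition ease t : R := (1 - cos (pi * t)) / 2.

Definition segment_pos t k : R := P 0 k + ease t * (Q 0 k - P 0 k).
Definition segment_curve t : 'rV[R]_r := \row_k psi (segment_pos t k).

Lemma ease01 t : 0 <= ease t <= 1.
Proof. by rewrite /ease; have := cos_geN1 (pi * t); have := cos_le1 (pi * t); lra. Qed.

Lemma segment_pos_ge (c : R) t k : c <= P 0 k -> c <= Q 0 k -> c <= segment_pos t k.
Proof. by rewrite /segment_pos; have /andP[] := ease01 t; nra. Qed.

Lemma segment_pos_le (c : R) t k : P 0 k <= c -> Q 0 k <= c -> segment_pos t k <= c.
Proof. by rewrite /segment_pos; have /andP[] := ease01 t; nra. Qed.

Lemma segment_pos_gt0 t k : 0 < segment_pos t k.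
Proof.
have P0 := oP.1 k; have Q0 := oQ.1 k.
apply: (@lt_le_trans _ _ (Num.min (P 0 k) (Q 0 k))); first by rewrite lt_min P0.
by apply: segment_pos_ge; rewrite ge_min lexx ?orbT.
Qed.

Lemma segment_pos_sum t : \sum_k segment_pos t k = 1.
Proof.
rewrite big_split/= -mulr_sumr sumrB oP.2 oQ.2 subrr mulr0 addr0//.
Qed.

Lemma segment_pos_lt1 t k : segment_pos t k < 1.
Proof.
exact: (simplex_lt1 r2 (segment_pos_gt0 t) (segment_pos_sum t)).
Qed.

Lemma phi_segment_curve t k : phi (segment_curve t 0 k) = segment_pos t k.
Proof.
rewrite mxE psiK// segment_pos_gt0/=.
by rewrite (lt_trans (segment_pos_lt1 _ _))// ltr1n.
Qed.

Lemma segment_curve_M1 t : M1 (segment_curve t).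
Proof.
apply/(M1P r2); split=> [k|].
  by rewrite -phi_lt1 phi_segment_curve segment_pos_lt1.
by rewrite -(segment_pos_sum t); apply: eq_bigr => k _; rewrite phi_segment_curve.
Qed.

Lemma smooth_segment_curve : smooth_curve segment_curve.
Proof.
apply: smooth_curve_row => k.
have sp : smooth_fun (fun t => segment_pos t k).
  rewrite (_ : (fun t => _) = (fun t => P 0 k + ((1 + - 1 * cos (pi * t)) * 2^-1) *
     (Q 0 k - P 0 k))); last first.
    by apply/funext => t; rewrite /segment_pos /ease mulN1r.
  apply: sm_add; first exact: sm_cst.
  apply: sm_mul; last exact: sm_cst.
  apply: sm_mul; last exact: sm_cst.
  apply: sm_add; first exact: sm_cst.
  by apply: sm_mul; [exact: sm_cst|exact: sm_cos].
rewrite (_ : (fun t => _) = (fun t => ln ((2 + - 1 * segment_pos t k) *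
    (segment_pos t k)^-1))); last first.
  by apply/funext => t; rewrite mxE /psi mulN1r.
apply: sm_ln.
  apply: sm_mul; last by apply: sm_inv => // t; rewrite gt_eqF// segment_pos_gt0.
  apply: sm_add; first exact: sm_cst.
  by apply: sm_mul => //; exact: sm_cst.
move=> t; have := segment_pos_gt0 t k; have := segment_pos_lt1 t k => *.
by rewrite divr_gt0//; lra.
Qed.

Lemma is_derive_segment_pos t k : is_derive t 1 (fun s => segment_pos s k)
  (pi / 2 * sin (pi * t) * (Q 0 k - P 0 k)).
Proof.
have d0 := derM (der_cst pi t) (der_id t).
have d1 := derD (der_cst 1 t) (derN (der_comp d0 (is_derive_cos _))).
have d2 := derM (derM d1 (der_cst 2^-1 t)) (der_cst (Q 0 k - P 0 k) t).
by apply: (is_derive_eq (derD (der_cst (P 0 k) t) d2)); ring.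
Qed.

Lemma segment_vel t k :
  vel_of segment_curve t k = pi / 2 * sin (pi * t) * (Q 0 k - P 0 k).
Proof.
have [_ <-] := is_derive_pos t k smooth_segment_curve.
rewrite (_ : (fun s => _) = (fun s => segment_pos s k)); last first.
  by apply/funext => s; rewrite /pos_of phi_segment_curve.
by case: (is_derive_segment_pos t k).
Qed.

(** Every coordinate is monotone along the segment, so the bound of [speed_le_sum] integrates to
    increments of [2 * sqrt (p k)]. Coordinate [i], staying in [[eta, 1 - eta]], keeps the
    denominator above [eta / 2 * psi (1 - eta)]. *)
Lemma segment_arc i (eta : R) : 0 < eta ->
  eta <= P 0 i <= 1 - eta -> eta <= Q 0 i <= 1 - eta ->
  exists2 L, M1arc segment_curve (length_coord P) (length_coord Q) L &
  L <= 2 * Num.sqrt (2 / (eta / 2 * psi (1 - eta))) *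
       \sum_k `|Num.sqrt (Q 0 k) - Num.sqrt (P 0 k)|.
Proof.
move=> eta0 /andP[P1 P2] /andP[Q1 Q2].
have eta1 : 0 < 1 - eta < 1 by apply/andP; split; lra.
have psi0 := psi_gt0 eta1.
set c := eta / 2 * psi (1 - eta).
have c0 : 0 < c by rewrite mulr_gt0// divr_gt0.
have sg := smooth_segment_curve.
have Mg t : 0 <= t <= 1 -> M1 (segment_curve t) by move=> _; exact: segment_curve_M1.
have gC := speed_continuous_seg r2 sg Mg.
have [G [_ _ GE]] := continuous_seg_primitive (@ltr01 R) gC.
exists (G 1 - G 0).
  split=> //.
  - apply/rowP => k; rewrite !mxE /segment_pos /ease mulr0 cos0 subrr.
    by rewrite !mul0r addr0.
  - apply/rowP => k; rewrite !mxE /segment_pos /ease mulr1 cospi opprK.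
    by rewrite divff ?mul1r ?pnatr_eq0// addrC subrK.
rewrite -lee_fin -GE.
(* The velocity of coordinate [k] has this sign on all of [[0, 1]], because [sin (pi * t) >= 0]
   there; so [dH], absolute values included, is the derivative of [H]. *)
pose sgn k : R := Num.sg (Q 0 k - P 0 k).
pose C := Num.sqrt (2 / c).
pose H t := \sum_k C * (sgn k * (2 * Num.sqrt (segment_pos t k))).
pose dH t := \sum_k C * (`|vel_of segment_curve t k| / Num.sqrt (segment_pos t k)).
have -> : 2 * Num.sqrt (2 / c) * \sum_k `|Num.sqrt (Q 0 k) - Num.sqrt (P 0 k)| =
    H 1 - H 0.
  rewrite /H -sumrB mulr_sumr; apply: eq_bigr => k _; rewrite -/C.
  have -> : segment_pos 1 k = Q 0 k.
    by rewrite /segment_pos /ease mulr1 cospi opprK divff ?mul1r ?pnatr_eq0// addrC subrK.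
  have -> : segment_pos 0 k = P 0 k.
    by rewrite /segment_pos /ease mulr0 cos0 subrr !mul0r addr0.
  suff -> : `|Num.sqrt (Q 0 k) - Num.sqrt (P 0 k)| =
      sgn k * (Num.sqrt (Q 0 k) - Num.sqrt (P 0 k)) by ring.
  rewrite /sgn; have P0 := oP.1 k; have Q0 := oQ.1 k.
  have [PQ|PQ|PQ] := ltgtP (P 0 k) (Q 0 k).
  - by rewrite gtr0_sg ?subr_gt0// mul1r ger0_norm// subr_ge0 ler_wsqrtr// ltW.
  - by rewrite ltr0_sg ?subr_lt0// mulN1r ler0_norm// subr_le0 ler_wsqrtr// ltW.
  - by rewrite PQ !subrr normr0 mulr0.
apply: (@integral_le_increment R _ H dH 0 1) => //.
  move=> t /andP[t0 t1]; apply: (der_sum xpredT) => k.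
  have sp0 := segment_pos_gt0 t k; have sq0 : 0 < Num.sqrt (segment_pos t k).
    by rewrite sqrtr_gt0.
  have d := der_comp (is_derive_segment_pos t k) (is_derive1_sqrt sp0).
  have d' := derM (der_cst C t) (derM (der_cst (sgn k) t) (derM (der_cst 2 t) d)).
  apply: (is_derive_eq d'); rewrite segment_vel normrM ger0_norm; last first.
    rewrite mulr_ge0 ?divr_ge0 ?pi_ge0// sin_ge0_pi//.
    by rewrite mulr_ge0 ?pi_ge0//= -[leRHS]mulr1 ler_pM2l ?pi_gt0.
  by rewrite normrEsg -/(sgn k); field; rewrite (gt_eqF sq0).
move=> t t01; rewrite speedE.
have pE : pos_of segment_curve t = segment_pos t.
  by apply/funext => k; rewrite /pos_of phi_segment_curve.
rewrite pE /dH.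
apply: (@speed_le_sum _ _ (segment_pos t) (vel_of segment_curve t) r2
  (segment_pos_gt0 t) (segment_pos_sum t) i c c0).
have h1 : eta <= segment_pos t i by exact: segment_pos_ge.
have h2 : segment_pos t i <= 1 - eta by exact: segment_pos_le.
rewrite /c /metric_den_term; apply: ler_pM; rewrite ?(ltW psi0) ?divr_ge0 ?(ltW eta0)//.
  rewrite ler_pM2r// -[leLHS]mulr1; apply: ler_pM => //; first exact: ltW.
  by lra.
(* [psi] is decreasing because its inverse [phi] is. *)
rewrite leNgt -ltr_phi -leNgt !psiK//; apply/andP; split; try lra.
Qed.

End Segment.
End SimplexCoordinates.

(** * Extension of a distance to a completion *)

Section Completion.
Variables (R : realType) (V : normedModType R).
Variables (S0 S : set V) (d : V -> V -> R) (C : R).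
Implicit Types (x y z p q : V) (e del : R).
Hypothesis V_complete : forall u : nat -> V, cauchy (u @ \oo) -> cvg (u @ \oo).
Hypothesis S0S : S0 `<=` S.
Hypothesis S0_dense : forall x, S x -> forall e, 0 < e ->
  exists2 p, S0 p & `|p - x| < e.
Hypothesis dxx : forall p, S0 p -> d p p = 0.
Hypothesis dC : forall p q, S0 p -> S0 q -> d p q = d q p.
Hypothesis dT : forall p q z, S0 p -> S0 q -> S0 z -> d p z <= d p q + d q z.
(** Points of [S0] near a common point of [S], possibly outside [S0], are close for [d]; this makes
    [d] converge at every pair of points of [S]. *)
Hypothesis d_small : forall x, S x -> forall e, 0 < e -> exists2 del, 0 < del &
  forall p q, S0 p -> S0 q -> `|p - x| < del -> `|q - x| < del -> d p q < e.
Hypothesis C0 : 0 < C.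
Hypothesis d_norm : forall p q, S0 p -> S0 q -> `|p - q| <= C * d p q.
(** [d_norm] turns a [d]-Cauchy sequence into a convergent one in [V]; this hypothesis places the
    limit in [S]. *)
Hypothesis d_cauchy : forall u : nat -> V, (forall n, S0 (u n)) ->
  (forall e, 0 < e -> exists N, forall m n, (N <= m)%N -> (N <= n)%N ->
     d (u m) (u n) < e) ->
  forall z, u @ \oo --> z -> S z.

(** The upper limit of [d] at [(x, y)] along [S0], defined without choosing sequences;
    [extended_dist_near] shows that it is a limit. *)
Definition extended_dist x y : R := inf [set c | exists2 del, 0 < del &
  forall p q, S0 p -> S0 q -> `|p - x| < del -> `|q - y| < del -> d p q < c].

Notation D := extended_dist.

Lemma d_diff p q p' q' : S0 p -> S0 q -> S0 p' -> S0 q' ->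
  `|d p q - d p' q'| <= d p p' + d q q'.
Proof.
move=> Sp Sq Sp' Sq'; rewrite ler_norml; apply/andP; split.
  have := dT Sp' Sp Sq'; have := dT Sp Sq Sq'; rewrite (dC Sp' Sp); lra.
have := dT Sp Sp' Sq; have := dT Sp' Sq' Sq; rewrite (dC Sq' Sq); lra.
Qed.

(** By [d_diff] and [d_small], [d] oscillates by less than [e / 2] near [(x, y)], so the infimum
    lies within [e / 2] of the value at one nearby pair, which density provides. *)
Lemma extended_dist_near x y e : S x -> S y -> 0 < e ->
  exists2 del, 0 < del & forall p q, S0 p -> S0 q ->
    `|p - x| < del -> `|q - y| < del -> `|d p q - D x y| <= e.
Proof.
move=> Sx Sy e0; have e4 : 0 < e / 4 by rewrite divr_gt0.
have [dx dx0 Hx] := d_small Sx e4; have [dy dy0 Hy] := d_small Sy e4.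
pose del := Num.min dx dy.
have del0 : 0 < del by rewrite lt_min dx0.
have near p q p' q' : S0 p -> S0 q -> S0 p' -> S0 q' ->
    `|p - x| < del -> `|q - y| < del -> `|p' - x| < del -> `|q' - y| < del ->
    `|d p q - d p' q'| < e / 2.
  move=> Sp Sq Sp' Sq'; rewrite !lt_min => /andP[px _] /andP[_ qy] /andP[p'x _] /andP[_ q'y].
  apply: (le_lt_trans (d_diff Sp Sq Sp' Sq')).
  by have := Hx _ _ Sp Sp' px p'x; have := Hy _ _ Sq Sq' qy q'y; lra.
have [p0 Sp0 p0x] := S0_dense Sx del0; have [q0 Sq0 q0y] := S0_dense Sy del0.
set A := [set c | exists2 del, 0 < del & forall p q, S0 p -> S0 q ->
  `|p - x| < del -> `|q - y| < del -> d p q < c].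
have A1 : A (d p0 q0 + e / 2).
  exists del => // p q Sp Sq px qy.
  by have := near _ _ _ _ Sp Sq Sp0 Sq0 px qy p0x q0y; rewrite ltr_norml; lra.
have A2 : lbound A (d p0 q0 - e / 2).
  move=> c [del' del'0 Hc]; have m0 : 0 < Num.min del del' by rewrite lt_min del0.
  have [p Sp] := S0_dense Sx m0; rewrite lt_min => /andP[px px'].
  have [q Sq] := S0_dense Sy m0; rewrite lt_min => /andP[qy qy'].
  have := Hc _ _ Sp Sq px' qy'.
  by have := near _ _ _ _ Sp Sq Sp0 Sq0 px qy p0x q0y; rewrite ltr_norml; lra.
have D1 : D x y <= d p0 q0 + e / 2 by apply: ge_inf => //; exists (d p0 q0 - e / 2).
have D2 : d p0 q0 - e / 2 <= D x y by apply: lb_le_inf => //; exists (d p0 q0 + e / 2).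
exists del => // p q Sp Sq px qy.
have := near _ _ _ _ Sp Sq Sp0 Sq0 px qy p0x q0y.
by rewrite ltr_norml ler_norml => /andP[? ?]; apply/andP; split; lra.
Qed.

Lemma extended_distE p q : S0 p -> S0 q -> D p q = d p q.
Proof.
move=> Sp Sq; apply/eqP; rewrite -subr_eq0 -normr_le0; apply/ler_addgt0Pl => e e0.
have [del del0 H] := extended_dist_near (S0S Sp) (S0S Sq) e0.
by rewrite addr0 distrC; apply: H => //; rewrite subrr normr0.
Qed.

Lemma extended_dist_approx x y e : S x -> S y -> 0 < e -> exists p q,
  [/\ S0 p, S0 q, `|p - x| < e, `|q - y| < e & `|d p q - D x y| <= e].
Proof.
move=> Sx Sy e0; have [del del0 H] := extended_dist_near Sx Sy e0.
have m0 : 0 < Num.min del e by rewrite lt_min del0.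
have [p Sp] := S0_dense Sx m0; rewrite lt_min => /andP[px px'].
have [q Sq] := S0_dense Sy m0; rewrite lt_min => /andP[qy qy'].
by exists p, q; split => //; exact: H.
Qed.

Lemma extended_dist_norm x y : S x -> S y -> `|x - y| <= C * D x y.
Proof.
move=> Sx Sy; apply/ler_addgt0Pl => e e0.
(* Moving the two points costs the tolerance twice, and moving the distance costs it [C] times. *)
have e'0 : 0 < e / (C + 2) by rewrite divr_gt0// addr_gt0.
have [p [q [Sp Sq px qy]]] := extended_dist_approx Sx Sy e'0.
rewrite ler_norml => /andP[_ dpq].
have eE : e = C * (e / (C + 2)) + 2 * (e / (C + 2)).
  by field; rewrite gt_eqF// addr_gt0.
have h : `|x - y| <= `|p - x| + `|p - q| + `|q - y|.
  rewrite (distrC p x); apply: le_trans (lerD (ler_normD _ _) (lexx _)).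
  by apply: le_trans (ler_normD _ _); rewrite subrKA subrKA.
have := d_norm Sp Sq.
have : C * d p q <= C * (D x y + e / (C + 2)) by rewrite ler_pM2l//; lra.
by rewrite mulrDr; lra.
Qed.

Lemma extended_distC x y : S x -> S y -> D x y = D y x.
Proof.
move=> Sx Sy; apply/eqP; rewrite -subr_eq0 -normr_le0; apply/ler_addgt0Pl => e e0.
have e2 : 0 < e / 2 by rewrite divr_gt0.
have [d1 d10 H1] := extended_dist_near Sx Sy e2.
have [d2 d20 H2] := extended_dist_near Sy Sx e2.
have m0 : 0 < Num.min d1 d2 by rewrite lt_min d10.
have [p Sp] := S0_dense Sx m0; rewrite lt_min => /andP[px px'].
have [q Sq] := S0_dense Sy m0; rewrite lt_min => /andP[qy qy'].
have := H1 _ _ Sp Sq px qy; have := H2 _ _ Sq Sp qy' px'.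
rewrite (dC Sq Sp) !ler_norml => /andP[? ?] /andP[? ?].
by apply/andP; split; lra.
Qed.

Lemma extended_distxx x : S x -> D x x = 0.
Proof.
move=> Sx; apply/eqP; rewrite -normr_le0; apply/ler_addgt0Pl => e e0.
have [d1 d10 H1] := extended_dist_near Sx Sx e0.
have [p Sp px] := S0_dense Sx d10.
by have := H1 _ _ Sp Sp px px; rewrite dxx// sub0r normrN addr0.
Qed.

Lemma extended_distT x y z : S x -> S y -> S z -> D x z <= D x y + D y z.
Proof.
move=> Sx Sy Sz; apply/ler_addgt0Pl => e e0.
have e3 : 0 < e / 3 by rewrite divr_gt0.
have [d1 d10 H1] := extended_dist_near Sx Sy e3.
have [d2 d20 H2] := extended_dist_near Sy Sz e3.
have [d3 d30 H3] := extended_dist_near Sx Sz e3.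
have m0 : 0 < Num.min (Num.min d1 d2) d3 by rewrite !lt_min d10 d20.
have [p Sp] := S0_dense Sx m0; rewrite !lt_min => /andP[/andP[p1 p2] p3].
have [q Sq] := S0_dense Sy m0; rewrite !lt_min => /andP[/andP[q1 q2] q3].
have [w Sw] := S0_dense Sz m0; rewrite !lt_min => /andP[/andP[w1 w2] w3].
have := H1 _ _ Sp Sq p1 q1; have := H2 _ _ Sq Sw q2 w2; have := H3 _ _ Sp Sw p3 w3.
have := dT Sp Sq Sw.
by rewrite !ler_norml => ? /andP[? ?] /andP[? ?] /andP[? ?]; lra.
Qed.

Lemma extended_dist_small x : S x -> forall e, 0 < e -> exists2 del, 0 < del &
  forall y, S y -> `|y - x| < del -> D x y < e.
Proof.
move=> Sx e e0; have e2 : 0 < e / 2 by rewrite divr_gt0.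
have [del del0 H] := d_small Sx e2.
exists (del / 2); first by rewrite divr_gt0.
move=> y Sy yx; pose m := Num.min (del / 2) (e / 4).
have m0 : 0 < m by rewrite lt_min !divr_gt0.
have [p [q [Sp Sq]]] := extended_dist_approx Sx Sy m0.
rewrite !lt_min => /andP[px _] /andP[qy _] dpq.
have qx : `|q - x| < del.
  by rewrite -(subrKA y) (le_lt_trans (ler_normD _ _))//; lra.
have px' : `|p - x| < del by lra.
have := H _ _ Sp Sq px' qx.
have : m <= e / 4 by rewrite ge_min lexx orbT.
by move: dpq; rewrite ler_norml; lra.
Qed.

Lemma extended_dist_large x : S x -> forall e, 0 < e -> exists2 del, 0 < del &
  forall y, S y -> D x y < del -> `|y - x| < e.
Proof.
move=> Sx e e0; exists (e / C); first by rewrite divr_gt0.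
move=> y Sy; rewrite ltr_pdivlMr// mulrC distrC.
exact: le_lt_trans (extended_dist_norm Sx Sy).
Qed.

Lemma extended_dist_dense z : S z -> forall e, 0 < e ->
  exists2 p, S0 p & D p z < e.
Proof.
move=> Sz e e0; have [del del0 H] := extended_dist_small Sz e0.
have [p Sp pz] := S0_dense Sz del0; exists p => //.
by rewrite extended_distC//; [exact: H (S0S Sp) pz|exact: S0S].
Qed.

(** Each [u n] is replaced by a point of [S0] at distance less than [1 / (n + 1)]. The new sequence
    is Cauchy for [d], hence for the norm; its limit lies in [S] by [d_cauchy], and convergence in
    norm implies convergence for the extended distance. *)
Lemma extended_dist_complete (u : nat -> V) : (forall n, S (u n)) ->
  (forall e, 0 < e -> exists N, forall m n, (N <= m)%N -> (N <= n)%N ->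
     D (u m) (u n) < e) ->
  exists2 z, S z & forall e, 0 < e -> exists N, forall n, (N <= n)%N -> D (u n) z < e.
Proof.
move=> Su uC.
have P n : exists p, S0 p /\ D p (u n) < n.+1%:R^-1.
  have n0 : 0 < n.+1%:R^-1 :> R by rewrite invr_gt0.
  by have [p Sp Dp] := extended_dist_dense (Su n) n0; exists p.
pose p n := projT1 (cid (P n)).
have pP n : S0 (p n) /\ D (p n) (u n) < n.+1%:R^-1 := projT2 (cid (P n)).
have inv_small e : 0 < e -> exists N, forall n, (N <= n)%N -> n.+1%:R^-1 < e :> R.
  move=> e0; exists (Num.trunc e^-1) => n Nn.
  rewrite -[ltRHS]invrK ltf_pV2 ?posrE ?invr_gt0//.
  by rewrite (lt_le_trans (truncnS_gt _))// ler_nat.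
have pC e : 0 < e -> exists N, forall m n, (N <= m)%N -> (N <= n)%N ->
    d (p m) (p n) < e.
  move=> e0; have e3 : 0 < e / 3 by rewrite divr_gt0.
  have [N1 H1] := uC _ e3; have [N2 H2] := inv_small _ e3.
  exists (maxn N1 N2) => m n; rewrite !geq_max => /andP[m1 m2] /andP[n1 n2].
  have [Sm Dm] := pP m; have [Sn Dn] := pP n.
  rewrite -extended_distE//.
  have := extended_distT (S0S Sm) (Su m) (S0S Sn).
  have := extended_distT (Su m) (Su n) (S0S Sn).
  rewrite (extended_distC (Su n) (S0S Sn)).
  have := lt_trans Dm (H2 _ m2); have := lt_trans Dn (H2 _ n2).
  by have := H1 _ _ m1 n1; lra.
have : cvg (p @ \oo).
  apply: V_complete; apply/cauchy_exP => e e0.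
  have eC : 0 < e / C by rewrite divr_gt0.
  have [N H] := pC _ eC; exists (p N); exists N => // n /= Nn.
  rewrite -ball_normE/=; apply: (le_lt_trans (d_norm (pP N).1 (pP n).1)).
  by rewrite mulrC -ltr_pdivlMr// H.
move=> /cvg_ex[/= z pz]; have Sz : S z.
  by apply: (d_cauchy (u := p)) pz => // n; exact: (pP n).1.
exists z => // e e0; have e2 : 0 < e / 2 by rewrite divr_gt0.
have [del del0 H] := extended_dist_small Sz e2.
have [N1 H1] := inv_small _ e2.
have /cvgrPdist_lt/(_ _ del0)[N2 _ H2] := pz.
exists (maxn N1 N2) => n; rewrite geq_max => /andP[n1 n2].
have [Sn Dn] := pP n.
have := H _ (S0S Sn); rewrite distrC => /(_ (H2 _ n2)).
have := extended_distT (Su n) (S0S Sn) Sz; have := lt_trans Dn (H1 _ n1).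
by rewrite (extended_distC (Su n) (S0S Sn)) (extended_distC Sz (S0S Sn)); lra.
Qed.

End Completion.

(** * The entropy distance on the simplex *)

Lemma row_coord_le (R : realType) (n : nat) (x : 'rV[R]_n) k : `|x 0 k| <= `|x|.
Proof.
rewrite [leRHS]/Num.Def.normr/= mx_normrE.
exact: (@le_bigmax _ _ _ _ (fun ij : 'I_1 * 'I_n => `|x ij.1 ij.2|) (0, k)).
Qed.

Lemma row_norm_le (R : realType) (n : nat) (x : 'rV[R]_n) (c : R) : 0 <= c ->
  (forall k, `|x 0 k| <= c) -> `|x| <= c.
Proof.
move=> c0 H; rewrite [leLHS]/Num.Def.normr/= mx_normrE (bigmax_le _ c0)//=.
by move=> [i k] _ /=; rewrite (ord1 i).
Qed.

(** Since [|u - v| <= u + v] for the two roots. The modulus of continuity is uniform down to [0], as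
    the faces require. *)
Lemma sqr_sub_sqrt_le (R : realType) (a b : R) : 0 <= a -> 0 <= b ->
  (Num.sqrt a - Num.sqrt b) ^+ 2 <= `|a - b|.
Proof.
move=> a0 b0; rewrite -[X in X - b](sqr_sqrtr a0) -[X in _ - X](sqr_sqrtr b0).
have := sqrtr_ge0 a; have := sqrtr_ge0 b.
set u := Num.sqrt a; set v := Num.sqrt b => v0 u0.
rewrite subr_sqr normrM (ger0_norm (addr_ge0 u0 v0)) -real_normK ?num_real//.
by rewrite expr2 ler_wpM2l// ler_norml; apply/andP; split; lra.
Qed.

Section Distance.
Variables (R : realType) (r : nat).
Hypothesis r2 : (2 <= r)%N.
Implicit Types (x y z P Q : 'rV[R]_r) (k i : 'I_r) (e : R).

Notation open_simplex := (@open_simplex R r).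

Definition simplex_dist P Q : R := inf (chain (length_coord P) (length_coord Q)).

Lemma chain_lbound x y : has_lbound (chain x y).
Proof. by exists 0 => L /(chain_ge0 r2). Qed.

(** Ensures that the real infimum [simplex_dist] is not a default value: the segment from [P] to [Q]
    is a chain. *)
Lemma chain_nonempty P Q : open_simplex P -> open_simplex Q ->
  chain (length_coord P) (length_coord Q) !=set0.
Proof.
move=> oP oQ; pose i := Ordinal r2.
pose eta := Num.min (Num.min (P 0 i) (1 - P 0 i)) (Num.min (Q 0 i) (1 - Q 0 i)).
have P0 := oP.1 i; have Q0 := oQ.1 i.
have P1 := open_simplex_lt1 r2 i oP; have Q1 := open_simplex_lt1 r2 i oQ.
have eta0 : 0 < eta by rewrite !lt_min P0 Q0 !subr_gt0 P1 Q1.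
have e1 : eta <= P 0 i by rewrite !ge_min lexx.
have e2 : eta <= 1 - P 0 i by rewrite !ge_min lexx !orbT.
have e3 : eta <= Q 0 i by rewrite !ge_min lexx !orbT.
have e4 : eta <= 1 - Q 0 i by rewrite !ge_min lexx !orbT.
have [||L LA _] := @segment_arc R r r2 P Q oP oQ i eta eta0.
- by rewrite e1; lra.
- by rewrite e3; lra.
- by exists L; exact: arc_chain LA.
Qed.

Lemma simplex_dist_le P Q L : chain (length_coord P) (length_coord Q) L ->
  simplex_dist P Q <= L.
Proof. by move=> c; apply: ge_inf => //; exact: chain_lbound. Qed.

Lemma simplex_dist_ge P Q (c : R) : open_simplex P -> open_simplex Q ->
  (forall L, chain (length_coord P) (length_coord Q) L -> c <= L) ->
  c <= simplex_dist P Q.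
Proof. by move=> oP oQ H; apply: lb_le_inf => //; exact: chain_nonempty. Qed.

Lemma entropy_dist_simplex x y : M1 x -> M1 y ->
  entropy_dist x y = (simplex_dist (simplex_coord x) (simplex_coord y))%:E.
Proof.
move=> Mx My; rewrite entropy_distE// /simplex_dist !simplex_coordK.
apply: ereal_inf_EFin; first exact: chain_lbound.
have := chain_nonempty (simplex_coord_M1 r2 Mx) (simplex_coord_M1 r2 My).
by rewrite !simplex_coordK.
Qed.

Lemma simplex_distxx P : open_simplex P -> simplex_dist P P = 0.
Proof.
move=> oP; apply/eqP; rewrite eq_le; apply/andP; split.
  by apply: simplex_dist_le; apply: chain_nil; exact: length_coord_M1.
by apply: simplex_dist_ge => // L /(chain_ge0 r2).
Qed.

Lemma simplex_distC P Q : simplex_dist P Q = simplex_dist Q P.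
Proof.
by congr inf; apply/seteqP; split => L /=; exact: chain_reverse.
Qed.

Lemma simplex_distT P Q Z : open_simplex P -> open_simplex Q -> open_simplex Z ->
  simplex_dist P Z <= simplex_dist P Q + simplex_dist Q Z.
Proof.
move=> oP oQ oZ; rewrite -lerBlDr; apply: simplex_dist_ge => // L1 c1.
rewrite lerBlDr -lerBlDl; apply: simplex_dist_ge => // L2 c2.
by rewrite lerBlDl; apply: simplex_dist_le; exact: chain_cat c1 c2.
Qed.

Lemma simplex_dist_norm P Q : open_simplex P -> open_simplex Q ->
  `|P - Q| <= 2 * r%:R * simplex_dist P Q.
Proof.
move=> oP oQ; have r0 : 0 < 2 * r%:R :> R by rewrite mulr_gt0// ltr0n ltnW.
have H k : `|P 0 k - Q 0 k| <= 2 * r%:R * simplex_dist P Q.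
  rewrite mulrC -ler_pdivrMr//; apply: simplex_dist_ge => // L c.
  rewrite ler_pdivrMr// mulrC distrC.
  by have := chain_coord r2 k c; rewrite !phi_length_coord.
apply: row_norm_le; first exact: le_trans (H (Ordinal r2)).
by move=> k; rewrite !mxE; exact: H.
Qed.

Lemma simplex_dist_depth P Q i : open_simplex P -> open_simplex Q ->
  `|vertex_depth r (Q 0 i) - vertex_depth r (P 0 i)| <= simplex_dist P Q.
Proof.
move=> oP oQ; apply: simplex_dist_ge => // L c.
by have := chain_vertex_depth r2 i c; rewrite !phi_length_coord.
Qed.

Lemma open_simplexS : open_simplex `<=` @simplex_minus_vertices R r.
Proof.
move=> P oP; have [P0 P1] := oP; split; first by move=> k; exact: ltW.
split=> // i; apply/eqP => PE.
by have := open_simplex_lt1 r2 i oP; rewrite PE mxE !eqxx ltxx.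
Qed.

Lemma open_simplex_dense x : simplex_minus_vertices x -> forall e, 0 < e ->
  exists2 P, open_simplex P & `|P - x| < e.
Proof.
move=> [x0 [x1 _]] e e0.
have r0 : 0 < r%:R :> R by rewrite ltr0n ltnW.
(* The barycentre: a small step towards it makes every coordinate positive. The [+ 1] in [t] covers
   the case where [x] is the barycentre. *)
pose b : 'rV[R]_r := \row_k r%:R^-1.
pose t := Num.min 1 (e / (`|b - x| + 1) / 2).
have n0 : 0 < `|b - x| + 1 by rewrite ltr_wpDl.
have t0 : 0 < t by rewrite lt_min ltr01 !divr_gt0.
have t1 : t <= 1 by rewrite ge_min lexx.
have te : t <= e / (`|b - x| + 1) / 2 by rewrite ge_min lexx orbT.
exists (x + t *: (b - x)); last first.
  rewrite addrAC subrr add0r normrZ gtr0_norm//.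
  apply: (@le_lt_trans _ _ (t * (`|b - x| + 1))); first by rewrite ler_pM2l// lerDl.
  apply: (le_lt_trans (ler_wpM2r (ltW n0) te)).
  by rewrite mulrAC divfK ?gt_eqF//; lra.
split=> [k|].
  rewrite !mxE; have := x0 k; have : 0 < r%:R^-1 :> R by rewrite invr_gt0.
  move: (r%:R^-1) => c c0 xk; nra.
under eq_bigr do rewrite !mxE.
rewrite big_split/= -mulr_sumr sumrB x1 sumr_const card_ord -[_ *+ _]mulr_natr.
by rewrite mulVf ?gt_eqF// subrr mulr0 addr0.
Qed.

(** A positive coordinate equal to [1] would force the others to vanish, giving a vertex. Through
    this the removal of the vertices enters the upper bound. *)
Lemma exists_intermediate_coord x : simplex_minus_vertices x ->
  exists i, 0 < x 0 i < 1.
Proof.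
move=> [x0 [x1 xv]].
have xle k : x 0 k <= 1.
  by rewrite -x1 (bigD1 k)//= lerDl; apply: sumr_ge0.
have [[i i0]|H] := pselect (exists i, 0 < x 0 i); last first.
  have : \sum_k x 0 k = 0.
    rewrite big1// => k _; apply/eqP; rewrite eq_le x0 andbT leNgt; apply/negP => xk.
    by apply: H; exists k.
  by rewrite x1 => /eqP; rewrite oner_eq0.
exists i; rewrite i0 lt_neqAle xle andbT; apply/eqP => xi1.
have /eqP : \sum_(k | k != i) x 0 k = 0.
  by move: x1; rewrite (bigD1 i)//= xi1; lra.
rewrite psumr_eq0// => /allP xk0.
have /eqP := xv i; apply; apply/rowP => k; rewrite !mxE eqxx/=.
have [->//|ki] := eqVneq k i.
by have := xk0 k (mem_index_enum k); rewrite ki => /eqP.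
Qed.

Lemma simplex_dist_small x : simplex_minus_vertices x -> forall e, 0 < e ->
  exists2 del : R, 0 < del & forall P Q, open_simplex P -> open_simplex Q ->
    `|P - x| < del -> `|Q - x| < del -> simplex_dist P Q < e.
Proof.
move=> Sx e e0; have [i /andP[xi0 xi1]] := exists_intermediate_coord Sx.
(* Half of the room around [x 0 i], so that points within [eta] of [x] keep coordinate [i] in
   [[eta, 1 - eta]]. *)
pose eta := Num.min (x 0 i) (1 - x 0 i) / 2.
have eta0 : 0 < eta by rewrite divr_gt0// lt_min xi0 subr_gt0.
have eta1 : 2 * eta <= x 0 i by rewrite /eta mulrC divfK ?ge_min ?lexx.
have eta2 : 2 * eta <= 1 - x 0 i by rewrite /eta mulrC divfK ?ge_min ?lexx ?orbT.
set c := 2 * Num.sqrt (2 / (eta / 2 * psi (1 - eta))).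
have c0 : 0 < c.
  have ps : 0 < psi (1 - eta) by apply: psi_gt0; apply/andP; split; lra.
  by rewrite mulr_gt0// sqrtr_gt0 divr_gt0// mulr_gt0// divr_gt0.
have r0 : 0 < r%:R :> R by rewrite ltr0n ltnW.
(* If each square root moves by at most [s], the length is at most [c * r * s = e / 2]; this holds
   once coordinates differ by at most [s ^ 2], hence [s ^ 2 / 2] in [del]. *)
pose s := e / (2 * (c * r%:R)).
have s0 : 0 < s by rewrite divr_gt0// mulr_gt0// mulr_gt0.
pose del := Num.min eta (s ^+ 2 / 2).
have del0 : 0 < del by rewrite lt_min eta0 divr_gt0// exprn_gt0.
exists del => // P Q oP oQ Px Qx.
have coord Z k : `|Z - x| < del -> `|Z 0 k - x 0 k| < del.
  by apply: le_lt_trans; have := row_coord_le (Z - x) k; rewrite !mxE.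
have eta_bnd Z : `|Z - x| < del -> eta <= Z 0 i <= 1 - eta.
  move=> /(coord _ i); rewrite lt_min ltr_norml => /andP[/andP[z1 z2] _].
  by apply/andP; split; lra.
have [L LA Lle] := segment_arc r2 oP oQ eta0 (eta_bnd _ Px) (eta_bnd _ Qx).
apply: (le_lt_trans (simplex_dist_le (arc_chain LA))).
apply: (le_lt_trans Lle); rewrite -/c.
have term k : `|Num.sqrt (Q 0 k) - Num.sqrt (P 0 k)| <= s.
  rewrite -(ler_pXn2r (n := 2))// ?nnegrE ?(ltW s0)// real_normK ?num_real//.
  have P0 := oP.1 k; have Q0 := oQ.1 k.
  apply: (le_trans (sqr_sub_sqrt_le (ltW Q0) (ltW P0))).
  have := coord _ k Px; have := coord _ k Qx.
  rewrite !lt_min => /andP[_ q1] /andP[_ p1].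
  rewrite -(subrKA (x 0 k)); apply: (le_trans (ler_normD _ _)).
  by rewrite (distrC (x 0 k)); lra.
apply: (@le_lt_trans _ _ (c * (\sum_(k < r) s))).
  by rewrite ler_pM2l//; apply: ler_sum => k _.
rewrite sumr_const card_ord -[s *+ r]mulr_natr.
have -> : c * (s * r%:R) = e / 2 by rewrite /s; field; rewrite !gt_eqF.
by lra.
Qed.

(* Cauchy sequences have bounded vertex depth, which keeps them away from the
   vertices. *)
Lemma simplex_dist_cauchy (u : nat -> 'rV[R]_r) : (forall n, open_simplex (u n)) ->
  (forall e, 0 < e -> exists N, forall m n, (N <= m)%N -> (N <= n)%N ->
     simplex_dist (u m) (u n) < e) ->
  forall z, u @ \oo --> z -> simplex_minus_vertices z.
Proof.
move=> ou uC z uz.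
have near e : 0 < e -> exists N, forall n, (N <= n)%N ->
    forall k, `|z 0 k - u n 0 k| < e.
  move=> e0; have /cvgrPdist_lt/(_ _ e0)[N _ H] := uz; exists N => n Nn k.
  by apply: le_lt_trans (H _ Nn); have := row_coord_le (z - u n) k; rewrite !mxE.
split; [|split].
- move=> k; rewrite leNgt; apply/negP => zk.
  have zk' : 0 < - z 0 k by rewrite oppr_gt0.
  have [N H] := near _ zk'; have := H N (leqnn N) k.
  by have := (ou N).1 k; rewrite ltr_norml => ? /andP[? ?]; lra.
- apply/eqP; rewrite -subr_eq0 -normr_le0; apply/ler_addgt0Pl => e e0.
  have r0 : 0 < r%:R :> R by rewrite ltr0n ltnW.
  have er : 0 < e / r%:R by rewrite divr_gt0.
  have [N H] := near _ er; rewrite addr0 -(ou N).2 -sumrB.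
  apply: (le_trans (ler_norm_sum _ _ _)).
  apply: (@le_trans _ _ (\sum_(k < r) (e / r%:R))).
    by apply: ler_sum => k _; exact: ltW (H N (leqnn N) k).
  by rewrite sumr_const card_ord -[leLHS]mulr_natr divfK// gt_eqF.
move=> i; apply/eqP => zE.
have zi : z 0 i = 1 by rewrite zE mxE !eqxx.
have [N H] := uC 1 ltr01.
pose B := vertex_depth r (u N 0 i) + 1.
(* Solving [vertex_depth p <= B] for [p] gives [1 - p >= kappa], so coordinate [i] cannot tend to
   [1]. *)
pose kappa := expR (2 * r.+1%:R - expR B).
have [N' H'] := near _ (expR_gt0 (2 * r.+1%:R - expR B)).
pose m := maxn N N'.
have := H' m (leq_maxr _ _) i; rewrite zi -/kappa.
have ui := open_simplex_lt1 r2 i (ou m).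
have ui0 := (ou m).1 i.
have e0 : 0 < 1 - u m 0 i by rewrite subr_gt0.
rewrite gtr0_norm// ltNge => /negP; apply.
have dB : vertex_depth r (u m 0 i) <= B.
  have := H N m (leqnn _) (leq_maxl _ _) => /ltW.
  move=> /(le_trans (simplex_dist_depth i (ou N) (ou m))).
  by rewrite ler_norml /B => /andP[_]; lra.
have ln0 : ln (1 - u m 0 i) <= 0 by rewrite ln_le0// gerBl ltW.
have K0 : 0 < 2 * r.+1%:R - ln (1 - u m 0 i).
  by rewrite subr_gt0 (le_lt_trans ln0)// mulr_gt0.
move: dB; rewrite /vertex_depth -ler_expR lnK ?posrE// => dB.
rewrite -[leRHS]lnK ?posrE// ler_expR.
move: dB; move: (2 * r.+1%:R) (expR B) (ln _) => *; lra.
Qed.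

End Distance.

Theorem theorem1p2 (R : realType) (r : nat) : (2 <= r)%N ->
  completion_homeomorphic_to (@M1 R r) (@entropy_dist R r)
    (@simplex_minus_vertices R r).
Proof.
move=> r2.
have complete (u : nat -> 'rV[R]_r) : cauchy (u @ \oo) -> cvg (u @ \oo).
  exact: cauchy_cvg.
have S0S := @open_simplexS R r r2; have dense := @open_simplex_dense R r r2.
have dxx := @simplex_distxx R r r2.
have dC P Q (_ : @open_simplex R r P) (_ : @open_simplex R r Q) :=
  @simplex_distC R r r2 P Q.
have dT := @simplex_distT R r r2; have small := @simplex_dist_small R r r2.
have C0 : 0 < 2 * r%:R :> R by rewrite mulr_gt0// ltr0n ltnW.
have norm := @simplex_dist_norm R r r2; have cauchy := @simplex_dist_cauchy R r r2.
exists (extended_dist (@open_simplex R r) (@simplex_dist R r)), (@simplex_coord R r).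
split; [|split; [|split; [|split; [|split; [|split; [|split; [|split]]]]]]].
- move=> x y Sx Sy; split=> [xy|->]; last exact: (extended_distxx dense).
  have := extended_dist_norm dense dC dT small C0 norm Sx Sy.
  by rewrite xy mulr0 normr_le0 subr_eq0 => /eqP.
- exact: extended_distC.
- exact: extended_distT.
- exact: extended_dist_small.
- exact: extended_dist_large C0 norm.
- exact: (extended_dist_complete complete S0S dense dC dT small C0 norm cauchy).
- by move=> x Mx; apply: S0S; exact: simplex_coord_M1.
- move=> x y Mx My; rewrite entropy_dist_simplex//.
  rewrite (extended_distE S0S dense dC dT small)//; exact: simplex_coord_M1.
- move=> z Sz e e0.
  have [P oP Pz] := extended_dist_dense S0S dense dC dT small Sz e0.
  by exists (length_coord P); [exact: length_coord_M1|rewrite length_coordK].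
Qed.
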